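(* Let $d\ge 3$ and $k\ge 1$ be integers. If $T\in\mathscr{S}_k^d$ and $\operatorname{Vol}(T)=\frac{1}{d!}(dk+1)$, then $T\simeq T_{a_1,\dots,a_d}$, where $(a_1,\dots,a_{d-1},a_d)=(dk,\dots,dk,dk+1)$.
   Context: $\operatorname{Vol}$ is $d$-dimensional Lebesgue volume. A lattice $d$-simplex is a nondegenerate ($d$-dimensional) simplex in $\mathbb{R}^d$ all of whose $d+1$ vertices lie in $\mathbb{Z}^d$. A lattice polytope $P$ is clean if the only points of $\mathbb{Z}^d$ on its boundary are its vertices. $\mathscr{S}_k^d$ is the collection of clean lattice $d$-simplices in $\mathbb{R}^d$ with exactly $k$ points of $\mathbb{Z}^d$ in their interior. For $(a_1,\dots,a_d)\in\mathbb{Z}^d$, $T_{a_1,\dots,a_d}$ denotes the $d$-simplex whose vertices are the origin, the unit vectors $e_1,\dots,e_{d-1}$, and the point $(a_1,\dots,a_d)$. A unimodular transformation is an affine map $f(v)=v\cdot M+u$ (row vectors) with $u\in\mathbb{Z}^d$ and $M$ a $d\times d$ integer matrix with $\det M=\pm1$. $P_1\simeq P_2$ means $P_1=f(P_2)$ for some unimodular transformation $f$. *)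

(* Defs.v *)
From HB Require Import structures.
From mathcomp Require Import all_boot all_order all_algebra.
From mathcomp Require Import all_classical all_reals all_analysis.

Set Implicit Arguments.
Unset Strict Implicit.
Unset Printing Implicit Defensive.

Import Order.TTheory GRing.Theory Num.Theory.
Import numFieldNormedType.Exports.

Local Open Scope classical_set_scope.
Local Open Scope ring_scope.

(* The d-fold product of the one-dimensional Lebesgue measure, transported from
   R * d.-tuple R to d.+1.-tuple R. The pieces are passed to [\x] as plain set
   functions; each is a sigma-finite measure on the product sigma-algebra. *)
Fixpoint lebesgue_tuple (R : realType) (d : nat) :
    set (d.-tuple (measurableTypeR R)) -> \bar R :=
  match d with
  | 0 => @dirac _ (0.-tuple (measurableTypeR R)) [tuple] R
  | d'.+1 => pushforward (@lebesgue_measure R \x @lebesgue_tuple R d')%E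
               (fun p => [tuple of p.1 :: p.2])
  end.

Definition Vol (R : realType) (d : nat) (A : set 'rV[R]_d) : \bar R :=
  @lebesgue_tuple R d [set t | A (\row_i tnth t i)].

Definition boundary (X : topologicalType) (A : set X) : set X :=
  closure A `\` interior A.

Definition real_point (R : realType) (d : nat) (z : 'rV[int]_d) : 'rV[R]_d :=
  map_mx intr z.

Definition simplex (R : realType) (d : nat) (p : 'I_d.+1 -> 'rV[R]_d) :
    set 'rV[R]_d :=
  [set x | exists w : 'I_d.+1 -> R,
     [/\ forall i, 0 <= w i, \sum_i w i = 1 & x = \sum_i w i *: p i]].

Definition affinely_independent (R : realType) (d : nat)
    (p : 'I_d.+1 -> 'rV[R]_d) : bool :=
  free [seq p (lift ord0 i) - p ord0 | i : 'I_d].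

Definition lattice_simplex (R : realType) (d : nat) (v : 'I_d.+1 -> 'rV[int]_d) :
    set 'rV[R]_d :=
  simplex (fun i => real_point R (v i)).

Definition is_lattice_simplex (R : realType) (d : nat)
    (v : 'I_d.+1 -> 'rV[int]_d) (T : set 'rV[R]_d) : Prop :=
  affinely_independent (fun i => real_point R (v i)) /\ T = lattice_simplex v.

(* Meant for T a simplex with vertex family v; a family is used because the
   vertices of a simplex are exactly its affinely independent generators. *)
Definition clean (R : realType) (d : nat) (v : 'I_d.+1 -> 'rV[int]_d)
    (T : set 'rV[R]_d) : Prop :=
  forall z : 'rV[int]_d, boundary T (real_point R z) -> exists i, z = v i.

Definition interior_lattice_points (R : realType) (d : nat)
    (T : set 'rV[R]_d) : set 'rV[int]_d :=
  [set z | interior T (real_point R z)].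

Definition clean_simplices (R : realType) (d k : nat) : set (set 'rV[R]_d) :=
  [set T | exists v : 'I_d.+1 -> 'rV[int]_d,
     [/\ is_lattice_simplex v T, clean v T
       & (interior_lattice_points T #= `I_k)%card]].
Arguments clean_simplices : clear implicits.

(* Vertices of T_{a_1,...,a_d}, with 0-based columns: [e_i] has its 1 in
   column [i - 1]. *)
Definition T_vertex (d : nat) (a : 'rV[int]_d) (i : 'I_d.+1) : 'rV[int]_d :=
  if i == 0%N :> nat then 0
  else if (i < d)%N then \row_(j < d) (j.+1 == i :> nat)%:R
  else a.

Definition T_simplex (R : realType) (d : nat) (a : 'rV[int]_d) : set 'rV[R]_d :=
  lattice_simplex (T_vertex a).

Definition unimodular_map (R : realType) (d : nat) (M : 'M[int]_d)
    (u : 'rV[int]_d) (x : 'rV[R]_d) : 'rV[R]_d :=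
  x *m map_mx intr M + real_point R u.

Definition unimodularly_equivalent (R : realType) (d : nat)
    (P1 P2 : set 'rV[R]_d) : Prop :=
  exists (M : 'M[int]_d) (u : 'rV[int]_d),
    (\det M = 1 \/ \det M = -1) /\ P1 = unimodular_map M u @` P2.

(* Main.v *)
From HB Require Import structures.
Require Import Defs.
From mathcomp Require Import all_boot all_order all_algebra.
From mathcomp Require Import all_classical all_reals all_analysis.
From mathcomp Require Import measurable_realfun.
From mathcomp Require Import zify ring.
From mathcomp Require Import fingroup perm.

(** Let v_0, .., v_d be the vertices of T and N = d k + 1.  The volume formula
    Vol T = |det W| / d!, with W the matrix of the edges v_i - v_0, says that the
    lattice spanned by the edges has index N in Z^d.  The quotient G is a group of
    order N: a class is recorded by the barycentric coordinates modulo 1 of its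
    points, that is by integers c_0, .., c_d in [0, N) to be divided by N.  Their
    sum is N times an integer, the age of the class, which lies between 0 and d.

    The elements of age one are the lattice points of T other than the vertices.
    As T is clean these are interior: there are k of them, and all their
    coordinates are positive, so that their opposites have age d.  Let A_i be the
    set of elements of age at most i, and S = A_1.  Ages are subadditive, so
    A_i + S is contained in A_(i+1), and Scherk's theorem gives
    |A_i + S| >= |A_i| + k for i < d, because 0 has only one representation in
    A_i + S.  Since |A_d| = N = d k + 1 all these inequalities are equalities;
    T is extremal in a sumset inequality.

    Extremality forces structure.  An isoperimetric argument (atom_subgroup,
    sumset_lower, exists_tight_pair) yields r <> 0 with |S + {0, r}| <= |S| + 1,
    hence S is an arithmetic progression 0, g, .., k g (exists_progression): there
    is no room for a coset of a subgroup inside S, because the elements of a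
    nontrivial coset have large ages on average (coset_card_age1).  Then t g has
    age equal to t / k rounded up, and comparing the coordinates of t g and of
    (d - 1) k g shows that each coordinate of g is 1 or at least N / 2
    (c_g_cases).  The coordinates of g add up to N, so all but one are equal to 1.

    Geometrically T contains a lattice point z with N (z - v_i) equal to the sum
    of the edges at some vertex v_i.  This relation, together with |det W| = N,
    determines T up to a unimodular transformation (unimodular_of_relation).

    The volume formula rests on the change of variables for linear maps
    (vol_scales_unit), proved by Gaussian elimination and Fubini's theorem, and on
    the volume of the standard simplex, obtained by integrating its slices. *)

Set Implicit Arguments.
Unset Strict Implicit.
Unset Printing Implicit Defensive.

Import Order.TTheory GRing.Theory Num.Theory.
Import numFieldNormedType.Exports.

Local Open Scope ring_scope.

(** * Sumsets in finite abelian groups *)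

(* [lia] compares cardinals up to conversion; it is run on plain variables. *)
Ltac natlia :=
  repeat match goal with
  | H : is_true (leq _ _) |- _ => revert H
  | H : @eq nat _ _ |- _ => revert H
  end;
  repeat match goal with
  | |- context [@card ?T ?p] => generalize (@card T p); intro
  end;
  repeat match goal with
  | |- context [?f ?x] =>
      match type of f with set_of _ -> nat => generalize (f x); intro end
  end;
  clear; intros; lia.

Section Sumset.
Import mathcomp.boot.fintype mathcomp.boot.finset.
Variable G : finZmodType.
Implicit Types (A B X Y S H : {set G}) (a b x y r : G).

Definition translate a X : {set G} := [set a + x | x in X].
Definition sumset A B : {set G} := [set a + b | a in A, b in B].

Lemma mem_translate a X x : (x \in translate a X) = (x - a \in X).
Proof.
apply/imsetP/idP=> [[y yX ->]|xX]; first by rewrite addrC addKr.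
by exists (x - a); rewrite // addrC subrK.
Qed.

Lemma card_translate a X : #|translate a X| = #|X|.
Proof. by rewrite card_imset //; apply: addrI. Qed.

Lemma mem_sumset A B a b : a \in A -> b \in B -> a + b \in sumset A B.
Proof. by move=> aA bB; apply/imset2P; exists a b. Qed.

Lemma sumsetP A B x :
  reflect (exists a b, [/\ a \in A, b \in B & x = a + b]) (x \in sumset A B).
Proof.
apply: (iffP imset2P) => [[a b aA bB ->]|[a [b [aA bB ->]]]].
  by exists a, b.
by exists a b.
Qed.

Lemma sumset_translate a X S : sumset (translate a X) S = translate a (sumset X S).
Proof.
apply/setP=> x; rewrite mem_translate; apply/sumsetP/sumsetP.
  case=> y [s []]; rewrite mem_translate => yX sS ->.
  by exists (y - a), s; rewrite addrAC.
case=> y [s [yX sS xE]]; exists (y + a), s; rewrite mem_translate addrK.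
by rewrite addrAC -xE subrK.
Qed.

Lemma sumset_subl A A' B : A \subset A' -> sumset A B \subset sumset A' B.
Proof. by move=> sAA'; apply: imset2S. Qed.

Lemma subset_sumset A S : 0 \in S -> A \subset sumset A S.
Proof.
by move=> S0; apply/subsetP=> a aA; rewrite -[a]addr0; apply: mem_sumset.
Qed.

(** Two sets with few neighbours thereby yield an intersection and a union with
    few neighbours, which is how all extremal sets below are cut down. *)
Lemma sumset_submodular X Y S :
  (#|sumset (X :&: Y) S| + #|sumset (X :|: Y) S| <=
   #|sumset X S| + #|sumset Y S|)%N.
Proof.
rewrite -[in leqRHS]cardsUI addnC leq_add //; apply/subset_leq_card/subsetP=> x.
  case/sumsetP=> y [s [yXY sS ->]]; move: yXY; rewrite !inE.
  by case/orP=> yX; apply/orP; [left|right]; apply: mem_sumset.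
case/sumsetP=> y [s [yXY sS ->]]; move: yXY; rewrite !inE.
by case/andP=> yX yY; apply/andP; split; apply: mem_sumset.
Qed.

(** By finiteness translation by b permutes A, and - b is the preimage of 0. *)
Lemma translate_closed_mem A b :
  0 \in A -> (forall a, a \in A -> a + b \in A) -> - b \in A.
Proof.
move=> A0 Ab; have sub : translate b A \subset A.
  by apply/subsetP=> x; rewrite mem_translate => /Ab; rewrite subrK.
have /eqP E : translate b A == A by rewrite eqEcard sub card_translate leqnn.
by rewrite -E in A0; rewrite mem_translate sub0r in A0.
Qed.

(** Scherk's theorem.  As long as a + B is not contained in A, the Dyson
    transform of A and B preserves |A| + |B|, shrinks B and does not enlarge the
    sumset; the unique representation of 0 survives the transform, and it
    excludes that A is invariant under a nonzero b in B. *)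
Lemma scherk A B : 0 \in A -> 0 \in B ->
  (forall a b, a \in A -> b \in B -> a + b = 0 -> b = 0) ->
  (#|A| + #|B| <= #|sumset A B| + 1)%N.
Proof.
have [n] := ubnP #|B|; elim: n A B => // n IH A B leBn A0 B0 uniq0.
have [/existsP[a /andP[aA /subsetPn[x]]]|/existsPn closedA] :=
    boolP [exists a in A, ~~ (translate a B \subset A)].
  rewrite mem_translate => xaB xA.
  pose A' := A :|: translate a B; pose B' := [set b in B | a + b \in A].
  have cardAB : (#|A'| + #|B'| = #|A| + #|B|)%N.
    have -> : #|B'| = #|A :&: translate a B|.
      rewrite -(card_translate a); congr #|pred_of_set _|; apply/setP=> y.
      by rewrite !inE !mem_translate !inE andbC addrC subrK.
    by rewrite cardsUI card_translate.
  have ltB' : (#|B'| < #|B|)%N.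
    apply/proper_card/properP; split.
      by apply/subsetP=> y; rewrite inE => /andP[].
    by exists (x - a) => //; rewrite inE xaB addrC subrK.
  rewrite -cardAB; apply: (@leq_trans (#|sumset A' B'| + 1)).
    apply: IH; rewrite ?inE ?A0 ?B0 ?addr0 //; first by natlia.
    move=> y b; rewrite !inE mem_translate => /orP[yA|yaB] /andP[bB abA] yb0.
      exact: uniq0 yb0.
    have: (a + b) + (y - a) = 0 by rewrite (addrC a) addrACA subrr addr0 addrC.
    move=> /(uniq0 _ _ abA yaB) ya0.
    have ya : y = a by apply/eqP; rewrite -subr_eq0 ya0.
    by rewrite ya in yb0; apply: uniq0 yb0.
  rewrite leq_add2r; apply/subset_leq_card/subsetP=> z /sumsetP[y [b []]].
  rewrite !inE mem_translate => /orP[yA|yaB] /andP[bB abA] ->.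
    exact: mem_sumset.
  have -> : y + b = (a + b) + (y - a).
    by rewrite (addrC a) addrACA subrr addr0 addrC.
  exact: mem_sumset.
have AB a b : a \in A -> b \in B -> a + b \in A.
  move=> aA bB; have := closedA a; rewrite aA /= negbK => /subsetP; apply.
  by rewrite mem_translate addrAC subrr add0r.
have -> : B = [set 0].
  apply/setP=> b; rewrite inE; apply/idP/eqP=> [bB|->//].
  apply: (uniq0 (- b) b) => //; last by rewrite addNr.
  by apply: translate_closed_mem => // a aA; apply: AB.
by rewrite cards1 leq_add2r; apply/subset_leq_card/subset_sumset; rewrite inE.
Qed.

(** Hamidoune's theorem on atoms.  Among the nonempty X with X + S <> G take those
    of smallest excess kap X = |X + S| - |X|, and among them a set M of smallest
    size, translated so as to contain 0.  The dual set - ~: (M + S) has excess at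
    most kap M, so it is at least as large as M, that is 2 |M| + kap M <= |G|.
    Hence, when M meets a translate M + a, submodularity leaves room for their
    union U to satisfy U + S <> G, and then makes their intersection a set of
    smallest excess; so M + a = M for every a in M, and M is a subgroup. *)
Lemma atom_subgroup X S k : 0 \in S -> X != set0 -> sumset X S != [set: G] ->
    (#|sumset X S| < #|X| + k)%N ->
  exists H, [/\ 0 \in H, forall x y, x \in H -> y \in H -> x + y \in H,
                sumset H S != [set: G] & (#|sumset H S| < #|H| + k)%N].
Proof.
move=> S0 X0 XG Xk.
have [g gC gT] : exists2 g, forall A : {set G}, (#|A| + #|~: A| = g)%N &
    forall A : {set G}, (A != [set: G]) = (#|A| < g)%N.
  exists #|G| => A; first exact: cardsC.
  by rewrite eqEcard subsetT /= cardsT -ltnNge.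
pose P (Y : {set G}) := (Y != set0) && (sumset Y S != [set: G]).
have [kap kapE] : exists kap : {set G} -> nat,
    forall Y, #|sumset Y S| = (#|Y| + kap Y)%N.
  exists (fun Y => #|sumset Y S| - #|Y|)%N => Y.
  by rewrite subnKC //; apply/subset_leq_card/subset_sumset.
have kapI (Y Z : {set G}) : #|Y| = #|Z| -> #|sumset Y S| = #|sumset Z S| -> kap Y = kap Z.
  by rewrite !kapE => -> /addnI.
have PX : P X by rewrite /P X0.
have [Y PY Ymin] : exists2 Y : {set G}, P Y &
    forall Z : {set G}, P Z -> (kap Y <= kap Z)%N.
  by case: (@arg_minnP _ X P kap PX) => Y; exists Y.
pose Q Z := P Z && (kap Z == kap Y).
have [M0 /andP[PM0 /eqP kM0] M0min] : exists2 M0 : {set G}, Q M0 &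
    forall Z : {set G}, Q Z -> (#|M0| <= #|Z|)%N.
  have QY : Q Y by rewrite /Q PY eqxx.
  by case: (@arg_minnP _ Y Q (fun Z => #|Z|) QY) => M0; exists M0.
have /set0Pn[m0 m0M] : M0 != set0 by case/andP: PM0.
pose M : {set G} := translate (- m0) M0.
have P_tr a Z : P (translate a Z) = P Z.
  have tr0 (W : {set G}) : (translate a W != set0) = (W != set0).
    by rewrite -!card_gt0 card_translate.
  have trT (W : {set G}) : (translate a W != [set: G]) = (W != [set: G]).
    by rewrite !gT card_translate.
  by rewrite /P tr0 sumset_translate trT.
have kap_tr a Z : kap (translate a Z) = kap Z.
  by apply: kapI; rewrite ?sumset_translate card_translate.
have cM a : #|translate a M| = #|M0| by rewrite !card_translate.
have PM : P M by rewrite P_tr.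
have kM : kap M = kap Y by rewrite kap_tr.
have M0' : 0 \in M by rewrite mem_translate opprK add0r.
have Mmin Z : P Z -> kap Z = kap Y -> (#|M0| <= #|Z|)%N.
  by move=> PZ kZ; apply: M0min; rewrite /Q PZ kZ eqxx.
have small : (#|M0| + #|M0| + kap Y <= g)%N.
  pose D : {set G} := [set - x | x in ~: sumset M0 S].
  have cD : (#|M0| + kap Y + #|D| = g)%N.
    by rewrite (card_imset _ (@oppr_inj G)) -kM0 -kapE gC.
  have DS : sumset D S \subset [set - x | x in ~: M0].
    apply/subsetP=> z /sumsetP[_ [s [/imsetP[x + ->] sS ->]]].
    rewrite inE => xMS; apply/imsetP; exists (x - s); last by rewrite opprB addrC.
    by rewrite inE; apply: contra xMS => xsM; rewrite -(subrK s x) mem_sumset.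
  have cDS : (#|M0| + #|sumset D S| <= g)%N.
    rewrite -(gC M0) leq_add2l; apply: leq_trans (subset_leq_card DS) _.
    by rewrite (card_imset _ (@oppr_inj G)).
  have M0pos : (0 < #|M0|)%N by apply/card_gt0P; exists m0.
  have M0S : (#|sumset M0 S| < g)%N by case/andP: PM0 => _; rewrite gT.
  rewrite kapE kM0 in M0S; rewrite kapE in cDS.
  clearbody D.
  have PD : P D.
    apply/andP; split; first by rewrite -card_gt0; natlia.
    by rewrite gT kapE; natlia.
  have kD : kap D = kap Y by apply/eqP; rewrite eqn_leq Ymin // andbT; natlia.
  by have := Mmin _ PD kD; natlia.
have stab a : a \in M -> translate a M = M.
  move=> aM; apply/eqP; rewrite eqEcard !card_translate leqnn andbT.
  pose I : {set G} := translate a M :&: M.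
  pose U : {set G} := translate a M :|: M.
  have aI : a \in I by rewrite inE mem_translate subrr M0'.
  have cUI : (#|U| + #|I| = #|M0| + #|M0|)%N by rewrite cardsUI !card_translate.
  have cI0 : (0 < #|I|)%N by apply/card_gt0P; exists a.
  have sub : (#|sumset I S| + #|sumset U S| <= #|M0| + kap Y + (#|M0| + kap Y))%N.
    apply: leq_trans (sumset_submodular _ _ _) _.
    by rewrite !kapE !kap_tr !card_translate kM0.
  have IM : I \subset M by apply: subsetIr.
  have PI : P I.
    apply/andP; split; first by apply/set0Pn; exists a.
    case/andP: PM => _; rewrite !gT.
    exact/leq_ltn_trans/subset_leq_card/sumset_subl.
  have kI : (kap Y <= kap I)%N by apply: Ymin.
  have kIE := kapE I; have kUE := kapE U.
  have IU : I \subset U by apply: subset_trans IM (subsetUr _ _).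
  have PU : P U.
    apply/andP; split; first by apply/set0Pn; exists a; apply: (subsetP IU).
    by rewrite gT kapE; natlia.
  have kU : (kap Y <= kap U)%N by apply: Ymin.
  have kIY : kap I = kap Y by natlia.
  have cIM := Mmin _ PI kIY.
  have IE : I = M by apply/eqP; rewrite eqEcard IM /= card_translate.
  have IT : I = translate a M.
    by apply/eqP; rewrite eqEcard subsetIl cM.
  by rewrite -IT IE.
exists M; split=> //.
- by move=> x y xM yM; rewrite -(stab x xM) mem_translate addrC addKr.
- by case/andP: PM.
- have kXY := Ymin _ PX; rewrite kapE in Xk.
  by rewrite kapE kM; natlia.
Qed.

End Sumset.
(** * Ages of residues of barycentric coordinates *)

(** As d (k - m) = a - 1 > 0 one has a >= d + 1, so t a <= d k forces t <= k.
    From (t + 1) a >= a + d m follows t a >= d m, whence (t - 1) a >= m because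
    t and d are at least 2; and (t - 1) a >= m is the second claim. *)
Lemma wrap_bound d k a m t : (3 <= d -> a + d * m = d * k + 1 -> 1 < a ->
    2 <= t -> t * a < d * k + 1 -> d * k + 1 <= t.+1 * a ->
  t <= k /\ d * k + 1 <= t * a + d.-1 * m)%N.
Proof.
case: d => // d d3 am a1 t2 ta Nt.
have mk : (m < k)%N by rewrite -(ltn_pmul2l (ltn0Sn d)); lia.
have [e ke] : exists e, k = (m + e)%N by exists (k - m)%N; lia.
have aE : a = (1 + d.+1 * e)%N by move: am; rewrite ke mulnDr; lia.
have e1 : (1 <= e)%N by lia.
split.
  rewrite leqNgt; apply/negP => kt.
  have : (k.+1 * d.+2 <= t * a)%N by apply: leq_mul => //; rewrite aE; nia.
  by move: ta; nia.
rewrite /= aE ke; move: Nt; rewrite aE ke => Nt.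
have te : (2 * e <= t * e)%N by rewrite leq_mul2r t2 orbT.
have tde : (2 * (d * e) <= t * (d * e))%N by rewrite leq_mul2r t2 orbT.
nia.
Qed.

Lemma eq_of_sum_leq (I : finType) (f g : I -> nat) :
  (forall i, f i <= g i)%N -> (\sum_i f i = \sum_i g i)%N -> f =1 g.
Proof.
move=> fg E i.
have /leqif_sum := fun i (_ : true) => leqif_eq (fg i).
by move=> -[_]; rewrite E eqxx => /esym/forallP/(_ i)/eqP.
Qed.

(** An axiomatic form of the group G described above: c j x / N are the
    barycentric coordinates of x modulo 1, and age x is their sum. *)
Section Age.
Import mathcomp.boot.fintype mathcomp.boot.finset.
Variables (G : finZmodType) (d k : nat).
Variables (c : 'I_d.+1 -> G -> nat) (age : G -> nat).
Let N := (d * k + 1)%N.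
Hypothesis d_ge3 : (3 <= d)%N.
Hypothesis k_gt0 : (1 <= k)%N.
Hypothesis c_lt : forall j x, (c j x < N)%N.
Hypothesis c_add : forall j x y, c j (x + y) = ((c j x + c j y) %% N)%N.
Hypothesis sum_c : forall x, (\sum_j c j x = N * age x)%N.
Hypothesis c_inj : forall x, (forall j, c j x = 0%N) -> x = 0.
Hypothesis card_G : #|[set: G]| = N.
Hypothesis card_age1 : #|[set x | age x == 1%N]| = k.
Hypothesis age1_pos : forall x, age x = 1%N -> forall j, (0 < c j x)%N.

Implicit Types (x y s h r : G) (X Y H : {set G}).

Let N_gt0 : (0 < N)%N. Proof. by rewrite /N addn1. Qed.

Lemma c_add_le j x y : (c j (x + y)%R <= c j x + c j y)%N.
Proof. by rewrite c_add leq_mod. Qed.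

Lemma c0 j : c j 0 = 0%N.
Proof.
have := c_add j 0 0; rewrite addr0; have := c_lt j 0.
case: (ltnP (c j 0 + c j 0) N) => [lt|ge] clt.
  by rewrite modn_small //; lia.
rewrite -[X in (X %% _)%N](subnK ge) modnDr modn_small; lia.
Qed.

Lemma age0 : age 0 = 0%N.
Proof.
have := sum_c 0; rewrite big1 => [/esym/eqP|j _]; last exact: c0.
by rewrite muln_eq0 (gtn_eqF N_gt0) => /eqP.
Qed.

Lemma age_eq0 x : age x = 0%N -> x = 0.
Proof.
move=> ax; apply: c_inj => j; have /eqP := sum_c x.
by rewrite ax muln0 sum_nat_eq0 => /forallP/(_ j)/eqP.
Qed.

Lemma c_pos_neg j x : (0 < c j x)%N -> (c j x + c j (- x) = N)%N.
Proof.
move=> cx; have := c_add j x (- x); rewrite subrr c0 => /esym/eqP.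
have := c_lt j x; have := c_lt j (- x).
case: (ltnP (c j x + c j (- x)) N) => [lt|ge] lt1 lt2.
  by rewrite modn_small //; lia.
rewrite -[X in (X %% _)%N](subnK ge) modnDr modn_small; lia.
Qed.

Lemma age_neg x : (forall j, 0 < c j x)%N -> (age x + age (- x) = d.+1)%N.
Proof.
move=> cx; apply/eqP; rewrite -(eqn_pmul2l N_gt0) mulnDr -!sum_c -big_split /=.
rewrite (eq_bigr (fun=> N)) => [|j _]; last by rewrite c_pos_neg.
by rewrite sum_nat_const card_ord mulnC.
Qed.

Lemma age1_neg x : age x = 1%N -> age (- x) = d.
Proof. by move=> ax; have := age_neg (age1_pos ax); rewrite ax => -[]. Qed.

Lemma age_le x : (age x <= d)%N.
Proof.
rewrite -ltnS -(ltn_pmul2l N_gt0) -sum_c.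
have : (\sum_(j < d.+1) c j x <= \sum_(j < d.+1) N.-1)%N.
  by apply: leq_sum => j _; have := c_lt j x; have := N_gt0; lia.
move=> /leq_ltn_trans; apply.
by rewrite sum_nat_const card_ord mulnC ltn_pmul2r // prednK ?leqnn ?N_gt0.
Qed.

Lemma age_add_le x y : (age (x + y)%R <= age x + age y)%N.
Proof.
rewrite -(leq_pmul2l N_gt0) mulnDr -!sum_c -big_split /=.
by apply: leq_sum => j _; apply: c_add_le.
Qed.

(** Ages add up exactly when no coordinate wraps around modulo N. *)
Lemma age_add_eq x y : age (x + y) = (age x + age y)%N ->
  forall j, c j (x + y) = (c j x + c j y)%N.
Proof.
move=> axy; apply: eq_of_sum_leq; first by move=> j; apply: c_add_le.
by rewrite big_split /= !sum_c axy mulnDr.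
Qed.

Definition ages_upto i : {set G} := [set x | age x <= i]%N.
Let S := ages_upto 1.

Lemma mem_ages_upto i x : (x \in ages_upto i) = (age x <= i)%N.
Proof. by rewrite inE. Qed.

Lemma mem_S0 : 0 \in S. Proof. by rewrite inE age0. Qed.

Lemma S_cases s : s \in S -> s = 0 \/ age s = 1%N.
Proof. by rewrite inE; case E: (age s) => [|[|]] // _; [left; apply: age_eq0|right]. Qed.

Lemma S_neg s : s \in S -> - s \in S -> s = 0.
Proof.
by move=> /S_cases[] // /age1_neg; rewrite inE leqNgt => ->; rewrite ltnW.
Qed.

Lemma card_ages_upto0 : #|ages_upto 0| = 1%N.
Proof.
rewrite -(cards1 (0 : G)); apply: eq_card => x; rewrite !inE leqn0.
by apply/eqP/eqP => [/age_eq0|->]; rewrite ?age0.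
Qed.

Lemma card_S : #|S| = k.+1.
Proof.
rewrite -(cardsID (ages_upto 0)) -add1n.
have <- : #|S :\: ages_upto 0| = k.
  by rewrite -card_age1; apply: eq_card => x; rewrite !inE; lia.
congr (_ + _)%N; rewrite -card_ages_upto0.
by apply: eq_card => x; rewrite !inE; lia.
Qed.

Lemma ages_upto_d : ages_upto d = [set: G].
Proof. by apply/setP=> x; rewrite !inE age_le. Qed.

Lemma sumset_ages_upto i : sumset (ages_upto i) S \subset ages_upto i.+1.
Proof.
apply/subsetP=> x /sumsetP[a [b [+ + ->]]]; rewrite !inE => ai b1.
by have := age_add_le a b; lia.
Qed.

(** The opposite of an element of age one has age d, so for i < d the only
    representation of 0 in A_i + S is 0 + 0, as Scherk's theorem requires. *)
Lemma card_sumset_ages_upto i : (i < d)%N ->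
  (#|ages_upto i| + k <= #|sumset (ages_upto i) S|)%N.
Proof.
move=> id; have: (#|ages_upto i| + #|S| <= #|sumset (ages_upto i) S| + 1)%N.
  apply: scherk; rewrite ?mem_S0 ?inE ?age0 // => a b.
  rewrite inE => ai bS /eqP; rewrite addr_eq0 => /eqP aE.
  by case: (S_cases bS) => // /age1_neg; rewrite -aE; lia.
by rewrite card_S addn1 addnS ltnS.
Qed.

Lemma card_ages_uptoS i : (i < d)%N ->
  (#|ages_upto i| + k <= #|ages_upto i.+1|)%N.
Proof.
move=> /card_sumset_ages_upto /leq_trans; apply.
exact/subset_leq_card/sumset_ages_upto.
Qed.

(** Each of the d steps from |A_0| = 1 to |A_d| = d k + 1 adds at least k
    elements, hence exactly k. *)
Lemma card_ages_upto i : (i <= d)%N -> #|ages_upto i| = (i * k + 1)%N.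
Proof.
move=> id.
have lower j : (j <= d)%N -> (j * k + 1 <= #|ages_upto j|)%N.
  elim: j => [|j IH] jd; first by rewrite card_ages_upto0.
  by have := IH (ltnW jd); have := card_ages_uptoS jd; rewrite mulSn; natlia.
have upper j : (i <= j)%N -> (j <= d)%N ->
    (#|ages_upto i| + (j - i) * k <= #|ages_upto j|)%N.
  elim: j => [|j IH] ij jd; first by move: ij; rewrite leqn0 => /eqP->; rewrite addn0.
  move: ij; rewrite leq_eqVlt => /predU1P[->|ij]; first by rewrite subnn addn0.
  by have := IH ij (ltnW jd); have := card_ages_uptoS jd; rewrite subSn // mulSn; natlia.
have := lower i id; have := upper d id (leqnn d).
rewrite ages_upto_d card_G /N mulnBl; have : (i * k <= d * k)%N by rewrite leq_mul2r id orbT.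
lia.
Qed.

Lemma sumset_ages_uptoE i : (i < d)%N -> sumset (ages_upto i) S = ages_upto i.+1.
Proof.
move=> id; apply/eqP; rewrite eqEcard sumset_ages_upto /= card_ages_upto //.
apply: leq_trans (card_sumset_ages_upto id).
by rewrite (card_ages_upto (ltnW id)) mulSn -addnA addnC.
Qed.

(** By the equality case an element of age i + 1 is the sum of elements of ages
    i and 1, with no wrap-around; so it inherits the full support of elements of
    age one. *)
Lemma c_gt0 x : x != 0 -> forall j, (0 < c j x)%N.
Proof.
suff full i : (i <= d)%N -> forall y, y \in ages_upto i -> y != 0 ->
    forall j, (0 < c j y)%N by apply: (full d); rewrite ?ages_upto_d.
clear x; elim: i => [|i IH] id x.
  by rewrite inE leqn0 => /eqP/age_eq0->; rewrite eqxx.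
rewrite inE leq_eqVlt => /predU1P[axi x0 j|xi]; last first.
  by apply: IH; rewrite ?inE // ltnW.
have: x \in ages_upto i.+1 by rewrite inE axi.
rewrite -sumset_ages_uptoE // => /sumsetP[a [b [ai bS xab]]].
have ab : age x = (age a + age b)%N.
  have := age_add_le a b; rewrite -xab; move: ai bS; rewrite !inE; lia.
rewrite xab age_add_eq -?xab // addn_gt0 orbC age1_pos //.
by move: ai bS; rewrite !inE; lia.
Qed.

Section Subgroup.
Variable H : {set G}.
Hypothesis H0 : 0 \in H.
Hypothesis HD : forall x y, x \in H -> y \in H -> x + y \in H.

Lemma subgroup_opp h : h \in H -> - h \in H.
Proof. by move=> hH; apply: translate_closed_mem => // x xH; apply: HD. Qed.

Lemma subgroup_memDl h x : h \in H -> (h + x \in H) = (x \in H).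
Proof.
move=> hH; apply/idP/idP=> [hxH|]; last exact: HD.
by rewrite -(addKr h x); apply: HD => //; apply: subgroup_opp.
Qed.

(** Opposite nonzero elements of H pair up to coordinate sum N. *)
Lemma subgroup_sum_c j : (2 * \sum_(h in H) c j h = (#|H| - 1) * N)%N.
Proof.
have sumN : (\sum_(h in H) c j h = \sum_(h in H) c j (- h))%N.
  rewrite (reindex_inj (@oppr_inj G)); apply: eq_bigl => h.
  by apply/idP/idP=> /subgroup_opp; rewrite ?opprK.
rewrite mul2n -addnn {2}sumN -big_split /= (bigD1 0) //= oppr0 c0 !add0n.
rewrite (eq_bigr (fun=> N)) => [|h /andP[_ h0]]; last by rewrite c_pos_neg ?c_gt0.
rewrite sum_nat_const; congr (_ * _)%N.
rewrite (cardD1 0 H) H0 add1n subn1 /=.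
by apply: eq_card => h; rewrite !inE andbC.
Qed.

(** Start the sum at the element of the coset with the smallest j-th coordinate:
    adding elements of H to it never wraps around. *)
Lemma coset_sum_c j s : s \notin H ->
  ((#|H| - 1) * N < 2 * \sum_(h in H) c j (s + h)%R)%N.
Proof.
move=> sH; have sS : s \in translate s H by rewrite mem_translate subrr.
case: (@arg_minnP _ s [in translate s H] (c j) sS) => x xS xmin.
rewrite mem_translate in xS.
have nowrap h : h \in H -> c j (x + h) = (c j x + c j h)%N.
  move=> hH; have xh : (c j x <= c j (x + h)%R)%N.
    by apply: xmin; rewrite mem_translate addrAC subgroup_memDl.
  have := c_add j x h; case: (ltnP (c j x + c j h) N) => [lt|ge].
    by rewrite modn_small.
  have cx := c_lt j x; have ch := c_lt j h.
  rewrite -[X in (X %% _)%N](subnK ge) modnDr modn_small; lia.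
have -> : (\sum_(h in H) c j (s + h)%R = \sum_(h in H) (c j x + c j h))%N.
  rewrite (reindex_inj (addrI (x - s))).
  apply: eq_big => [h|h]; first by rewrite subgroup_memDl.
  rewrite subgroup_memDl // => hH; rewrite -nowrap //.
  by rewrite addrA addrCA subrr addr0.
have x0 : x != 0.
  apply: contraNneq sH => x0; move: xS; rewrite x0 sub0r.
  by move=> /subgroup_opp; rewrite opprK.
rewrite big_split /= mulnDr subgroup_sum_c sum_nat_const.
have H_gt0 : (0 < #|H|)%N by apply/card_gt0P; exists 0.
by rewrite -[ltnLHS]add0n ltn_add2r !muln_gt0 H_gt0 c_gt0.
Qed.

(** The ages on a coset other than H add up to more than (d + 1) (|H| - 1) / 2.
    No age exceeds d, so, d being at least 3, about half of the elements at most
    can have an age as small as one. *)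
Lemma coset_card_age1 s : s \notin H ->
  (2 * #|[set h in H | age (s + h)%R == 1%N]| <= #|H| + 1)%N.
Proof.
move=> sH; set x := #|_|.
have lower : (d.+1 * (#|H| - 1) < 2 * \sum_(h in H) age (s + h)%R)%N.
  rewrite -(ltn_pmul2l N_gt0) [ltnRHS]mulnCA big_distrr /=.
  rewrite [X in (_ < 2 * X)%N](eq_bigr (fun h => \sum_j c j (s + h)%R)%N) => [|h _].
    rewrite exchange_big /= big_distrr /=.
    apply: (@leq_trans (\sum_(j < d.+1) ((#|H| - 1) * N).+1)%N).
      by rewrite sum_nat_const card_ord [ltnLHS]mulnC -mulnA ltn_pmul2l.
    by apply: leq_sum => j _; apply: coset_sum_c.
  by rewrite sum_c.
have xH : (x + #|[set h in H | age (s + h)%R != 1%N]| = #|H|)%N.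
  rewrite -(cardsID [set h | age (s + h)%R == 1%N] H); congr (_ + _)%N.
    by apply: eq_card => h; rewrite !inE.
  by apply: eq_card => h; rewrite !inE andbC.
have upper : (\sum_(h in H) age (s + h)%R <= x + (#|H| - x) * d)%N.
  rewrite (bigID (fun h => age (s + h)%R == 1%N)) /=; apply: leq_add.
    rewrite (eq_bigr (fun=> 1%N)) => [|h /andP[_ /eqP]//].
    by rewrite sum1dep_card.
  rewrite -xH addKn -sum1dep_card big_distrl /= leq_sum // => h _.
  by rewrite mul1n age_le.
have xle : (x <= #|H|)%N by rewrite -xH leq_addr.
move: lower upper xle; clearbody x; move: #|H| (\sum_(h in H) _)%N.
move=> n t; clear -d_ge3; nia.
Qed.

End Subgroup.

Lemma sumset_neqT X : (#|sumset X S| < N)%N -> sumset X S != [set: G].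
Proof. by apply: contraTneq => ->; rewrite card_G ltnn. Qed.

(** Otherwise an atom gives a subgroup H with |H + S| < |H| + k, so that H + S has
    fewer than |H| - 1 elements outside S.  Now S is not contained in H, because S
    generates G; let s be in S but not in H.  But S has at most (|H| + 1) / 2
    elements in H, as it contains no two opposite nonzero elements, and at most as
    many in the coset of s, which leaves |H| - 1 elements outside S. *)
Lemma sumset_lower X : X != set0 -> sumset X S != [set: G] ->
  (#|X| + k <= #|sumset X S|)%N.
Proof.
move=> X0 XG; rewrite leqNgt; apply/negP => Xk.
have [H [H0 HD HSG HSk]] := atom_subgroup mem_S0 X0 XG Xk.
have [SH|/subsetPn[s sS sH]] := boolP (S \subset H).
  have HT i : (i <= d)%N -> ages_upto i \subset H.
    elim: i => [|m IH] md.
      by apply: subset_trans SH; apply/subsetP=> y; rewrite !inE; lia.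
    rewrite -sumset_ages_uptoE //; apply/subsetP=> y /sumsetP[a [b [aA bS ->]]].
    by apply: HD; [apply: (subsetP (IH (ltnW md)))|apply: (subsetP SH)].
  move/eqP: HSG; apply; apply/setP=> x; rewrite inE.
  apply: (subsetP (subset_sumset H mem_S0)); apply: (subsetP (HT d (leqnn d))).
  by rewrite inE age_le.
have half1 : (2 * #|S :&: H| <= #|H| + 1)%N.
  have cN : #|[set - x | x in S :&: H]| = #|S :&: H|.
    by rewrite (card_imset _ (@oppr_inj G)).
  rewrite mul2n -addnn -{2}cN -cardsUI; apply: leq_add.
    apply: subset_leq_card; rewrite subUset subsetIr /=.
    by apply/subsetP=> _ /imsetP[y + ->]; rewrite inE => /andP[_ /(subgroup_opp H0 HD)].
  rewrite -(cards1 (0 : G)); apply: subset_leq_card; apply/subsetP=> y.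
  rewrite !inE => /andP[/andP[yS _] /imsetP[z + yz]]; rewrite inE => /andP[zS _].
  by apply/eqP/S_neg; [rewrite inE | rewrite yz opprK].
have half2 : (2 * #|S :&: translate s H| <= #|H| + 1)%N.
  apply: leq_trans (coset_card_age1 H0 HD sH); rewrite leq_mul2l /=.
  rewrite -[leqRHS](card_translate s); apply/subset_leq_card/subsetP=> y.
  rewrite inE !mem_translate !inE (addrC s) subrK => /andP[y1 ysH].
  rewrite ysH /=; have y0 : y != 0.
    apply: contraNneq sH => y0; move: ysH; rewrite y0 sub0r.
    by move=> /(subgroup_opp H0 HD); rewrite opprK.
  by rewrite eqn_leq y1 lt0n; apply: contraNN y0 => /eqP/age_eq0->.
pose V := H :|: translate s H.
have cV : #|V| = (#|H| + #|H|)%N.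
  have := cardsUI H (translate s H); rewrite card_translate => <-.
  have -> : H :&: translate s H = set0.
    apply/setP=> y; rewrite !inE mem_translate; apply: contraNF sH => /andP[yH ysH].
    by rewrite -[s](subrK y) -opprB addrC subgroup_memDl ?subgroup_opp.
  by rewrite cards0 addn0.
have SV : (#|S :|: V| + #|S :&: V| = k.+1 + (#|H| + #|H|))%N.
  by rewrite cardsUI card_S cV.
have SVI : (#|S :&: V| <= #|S :&: H| + #|S :&: translate s H|)%N.
  by rewrite setIUr -cardsUI leq_addr.
have SVU : (#|S :|: V| <= #|sumset H S|)%N.
  apply/subset_leq_card/subsetP=> y; rewrite !inE => /orP[y1|/orP[yH|]].
  - by rewrite -[y]add0r mem_sumset ?inE.
  - by apply: (subsetP (subset_sumset H mem_S0)).
  - by rewrite mem_translate => ysH; rewrite -[y](subrK s) mem_sumset.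
move: HSk half1 half2 SV SVI SVU; natlia.
Qed.
(** The reverse of the inequality of sumset_lower, so X is extremal for it. *)
Definition tight X := (#|sumset X S| <= #|X| + k)%N.

(** An element b of X with the single representation b + 0 in X + S leaves the
    sumset together with X, so removing it does not increase the excess. *)
Lemma tight_rem X b : b \in X -> tight X ->
  (forall a s, a \in X -> s \in S -> b = a + s -> a = b) -> tight (X :\ b).
Proof.
rewrite /tight => bX tX uniqb.
have sub : sumset (X :\ b) S \subset sumset X S :\ b.
  apply/subsetP=> y /sumsetP[a [s [+ sS ->]]]; rewrite !inE => /andP[ab aX].
  rewrite mem_sumset // andbT; apply: contraNneq ab => E.
  by rewrite (uniqb a s).
have bXS : b \in sumset X S by apply: (subsetP (subset_sumset X mem_S0)).
have := subset_leq_card sub; have := cardsD1 b (sumset X S); have := cardsD1 b X.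
rewrite bX bXS; move: tX; natlia.
Qed.

(** Among the tight subsets of S with at least two elements, such as S, a smallest
    one X is a pair {a, b}, and r = b - a.  Suppose X had three elements.  Then no
    element of X can be removed, so some b in X is a + s with a in X different
    from b.  By submodularity (X - a) :&: S is tight, the union of X - a and S
    being small enough for sumset_lower; it contains 0 and s.  By minimality it
    has as many elements as X, but 0 can be removed from it. *)
Lemma exists_tight_pair : exists2 r : G, r != 0 & (#|S :|: translate r S| <= k.+2)%N.
Proof.
pose P (X : {set G}) := [&& X \subset S, (2 <= #|X|)%N & tight X].
have cSS : #|sumset S S| = (2 * k + 1)%N.
  by rewrite sumset_ages_uptoE ?card_ages_upto //; lia.
have PS : P S by rewrite /P subxx card_S /tight cSS card_S; lia.
have [X /and3P[XS X2 tX] Xmin] : exists2 X : {set G}, P X &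
    forall Z : {set G}, P Z -> (#|X| <= #|Z|)%N.
  by case: (@arg_minnP _ S P (fun Z => #|Z|) PS) => X; exists X.
have remP (Z : {set G}) (b : G) : Z \subset S -> (3 <= #|Z|)%N -> tight Z -> b \in Z ->
    (forall a s, a \in Z -> s \in S -> b = a + s -> a = b) -> (#|X| < #|Z|)%N.
  move=> ZS Z3 tZ bZ uniqb; have := cardsD1 b Z; rewrite bZ => cZ.
  rewrite cZ ltnS; apply: Xmin; rewrite /P tight_rem // andbT.
  apply/andP; split; first exact: subset_trans (subsetDl _ _) ZS.
  by move: Z3; rewrite cZ.
have X_le2 : (#|X| <= 2)%N.
  rewrite leqNgt; apply/negP => X3.
  have [b bX] : exists b : G, b \in X by apply/card_gt0P; apply: ltnW; apply: ltnW.
  have [a [s [aX sS bas ab]]] : exists a s : G, [/\ a \in X, s \in S, b = a + s & a != b].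
    have [/existsP[a /andP[aX /andP[ab bS]]]|/existsPn none] :=
        boolP [exists a in X, (a != b) && (b - a \in S)].
      by exists a, (b - a); split=> //; rewrite addrC subrK.
    suff: (#|X| < #|X|)%N by rewrite ltnn.
    apply: (remP X b) => // a s aX sS bas; apply/eqP; have := none a.
    by rewrite aX bas (addrC a) addrK sS andbT /= negbK.
  pose Y : {set G} := translate (- a) X :&: S.
  pose W : {set G} := translate (- a) X :|: S.
  have Y0 : 0 \in Y by rewrite inE mem_translate opprK add0r aX mem_S0.
  have YS : Y \subset S by apply: subsetIr.
  have Y2 : (2 <= #|Y|)%N.
    rewrite (cardsD1 0) Y0 (cardsD1 s) !inE mem_translate opprK addrC -bas bX.
    rewrite -mem_ages_upto sS !andbT; suff -> : s != 0 by [].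
    by apply: contraNneq ab => s0; rewrite bas s0 addr0.
  have cXS : (#|X| <= k.+1)%N by rewrite -card_S subset_leq_card.
  have kk : (3 * k < N)%N by rewrite /N; clear -d_ge3 k_gt0; nia.
  have lowY : (#|Y| + k <= #|sumset Y S|)%N.
    apply: sumset_lower; first by apply/set0Pn; exists 0.
    apply: sumset_neqT; have := subset_leq_card (sumset_subl S YS).
    rewrite cSS; move: kk; natlia.
  have sub : (#|sumset Y S| + #|sumset W S| <= #|X| + k + (2 * k + 1))%N.
    apply: leq_trans (sumset_submodular _ _ _) _; rewrite cSS.
    by rewrite sumset_translate card_translate leq_add2r.
  have lowW : (#|W| + k <= #|sumset W S|)%N.
    apply: sumset_lower; first by apply/set0Pn; exists 0; rewrite inE orbC mem_S0.
    by apply: sumset_neqT; move: sub lowY Y2 cXS kk; natlia.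
  have cWY : (#|W| + #|Y| = #|X| + k.+1)%N by rewrite cardsUI card_translate card_S.
  have tY : tight Y by rewrite /tight; move: sub lowW cWY; natlia.
  have cYX : (#|Y| <= #|X|)%N by rewrite -(card_translate (- a) X) subset_leq_card ?subsetIl.
  have XY : (#|X| <= #|Y|)%N by apply: Xmin; rewrite /P YS Y2.
  have : (#|X| < #|Y|)%N.
    apply: (remP Y 0) => //; first exact: leq_trans XY.
    move=> y z /(subsetP YS) yS zS /esym/eqP; rewrite addr_eq0 => /eqP yz.
    by apply: S_neg => //; rewrite yz opprK.
  by rewrite ltnNge cYX.
have /cards2P[a [b [ab XE]]] : #|X| == 2%N by rewrite eqn_leq X_le2 X2.
exists (b - a); first by rewrite subr_eq0 eq_sym.
have : (#|sumset X S| <= k.+2)%N.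
  by apply: leq_trans tX _; rewrite XE cards2 ab.
rewrite -(card_translate (- a)) -sumset_translate; apply: leq_trans.
apply/subset_leq_card/subsetP=> y; rewrite inE => /orP[yS|].
  rewrite -[y]add0r mem_sumset // mem_translate opprK add0r XE inE.
  by rewrite in_set1 eqxx.
rewrite mem_translate => ybS; rewrite -[y](subrK (b - a)) addrC mem_sumset //.
by rewrite mem_translate opprK subrK XE !inE eqxx orbT.
Qed.

(** The stabilizer H of Z contains r, so Z contains a full coset of a nontrivial
    subgroup; but at most (|H| + 1) / 2 of its elements have age one. *)
Lemma no_periodic_subset Z r : r != 0 -> Z != set0 ->
    (forall x, x \in Z -> age x = 1%N) ->
  ~ (forall x, x \in Z -> x + r \in Z).
Proof.
move=> r0 /set0Pn[x xZ] Z1 Zr.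
pose H : {set G} := [set h | translate h Z == Z].
have ZH y h : y \in Z -> h \in H -> y + h \in Z.
  by rewrite inE => yZ /eqP <-; rewrite mem_translate addrK.
have H0 : 0 \in H by rewrite inE; apply/eqP/setP=> y; rewrite mem_translate subr0.
have HD y z : y \in H -> z \in H -> y + z \in H.
  rewrite !inE => /eqP yH /eqP zH; apply/eqP/setP=> t.
  by rewrite mem_translate opprD addrA -mem_translate zH -mem_translate yH.
have rH : r \in H.
  rewrite inE eqEcard card_translate leqnn andbT; apply/subsetP=> y.
  by rewrite mem_translate => /Zr; rewrite subrK.
have xH : x \notin H.
  apply/negP => /(subgroup_opp H0 HD)/(ZH x _ xZ); rewrite subrr => /Z1.
  by rewrite age0.
have := coset_card_age1 H0 HD xH.
have -> : [set h in H | age (x + h) == 1%N] = H.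
  by apply/setP=> h; rewrite inE; case hH: (h \in H); rewrite //= Z1 ?eqxx // ZH.
rewrite (cardsD1 0) H0 (cardsD1 r) !inE r0 /=.
by rewrite inE in rH; rewrite rH; lia.
Qed.

Lemma age1_not_opp x : age x = 1%N -> - x \notin S.
Proof. by move=> ax; rewrite inE (age1_neg ax) -ltnNge ltnW. Qed.

Lemma age1_neq0 x : age x = 1%N -> x != 0.
Proof. by move=> ax; apply/eqP => x0; rewrite x0 age0 in ax. Qed.

Lemma tight_pair_neg r : (#|S :|: translate r S| <= k.+2)%N ->
  (#|S :|: translate (- r) S| <= k.+2)%N.
Proof.
move=> le; rewrite -(card_translate r); apply: leq_trans le.
apply/subset_leq_card/subsetP=> y.
by rewrite mem_translate !in_setU !mem_translate opprK subrK orbC.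
Qed.

(** Each element that leaves S when r is added enlarges the union. *)
Lemma tight_pair_exit r x y : (#|S :|: translate r S| <= k.+2)%N ->
  x \in S -> x + r \notin S -> y \in S -> y + r \notin S -> x = y.
Proof.
move=> le xS xrS yS yrS; apply/eqP; apply: contraLR le => xy; rewrite -ltnNge.
have sub : (x + r) |: ((y + r) |: S) \subset S :|: translate r S.
  apply/subsetP=> z; rewrite in_setU1 in_setU1 in_setU mem_translate.
  by case/or3P=> [/eqP->|/eqP->|->] //; rewrite addrK ?xS ?yS orbT.
apply: leq_trans (subset_leq_card sub).
by rewrite !cardsU1 card_S in_setU1 (inj_eq (addIr r)) (negPf xy) (negPf xrS) (negPf yrS).
Qed.

Lemma mulrn_notin_S r : age r = 1%N -> exists n, r *+ n \notin S.
Proof.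
move=> r1; exists (fingroup.order r).-1; rewrite [r *+ _](_ : _ = - r) ?age1_not_opp //.
apply/eqP; rewrite -subr_eq0 opprK -mulrSr prednK ?fingroup.order_gt0 //.
by rewrite -FinRing.zmodXgE fingroup.expg_order.
Qed.

(** With r from exists_tight_pair, r or - r lies in S: otherwise 0 is the one
    element which leaves S when r is added, and adding r permutes the others.  Take
    r in S as g.  Subtracting g, the element 0 is again the one that leaves S; so
    the elements of S outside the progression 0, g, 2 g, .. would be permuted, and
    S is that progression. *)
Lemma exists_progression : exists g : G, forall t, (1 <= t <= k)%N -> age (g *+ t) = 1%N.
Proof.
have [r [r0 r1 tr]] : exists r : G, [/\ r != 0, age r = 1%N &
    (#|S :|: translate r S| <= k.+2)%N].
  have [r r0 tr] := exists_tight_pair.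
  have [rS|rS] := boolP (r \in S).
    by exists r; split=> //; case: (S_cases rS) => // r00; rewrite r00 eqxx in r0.
  have [rS'|rS'] := boolP (- r \in S).
    exists (- r); rewrite tight_pair_neg // oppr_eq0; split=> //.
    by case: (S_cases rS') => // /eqP; rewrite oppr_eq0 (negPf r0).
  exfalso; apply: (@no_periodic_subset [set x | age x == 1%N] r r0).
  - by rewrite -card_gt0 card_age1.
  - by move=> x; rewrite inE => /eqP.
  - move=> x; rewrite inE => /eqP ax; rewrite inE.
    have xS : x \in S by rewrite inE ax.
    have : x + r \in S.
      apply: contraNT (age1_neq0 ax) => xrS; apply/eqP.
      by apply: (tight_pair_exit tr) => //; rewrite ?mem_S0 ?add0r.
    case/S_cases=> [/eqP|->//]; rewrite addr_eq0 => /eqP xr.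
    by rewrite xr in xS; rewrite xS in rS'.
exists r => t /andP[t1 tk].
have [n nS nmin] := ex_minnP (mulrn_notin_S r1).
have inS m : (m < n)%N -> r *+ m \in S.
  by move=> mn; apply: contraLR mn => /nmin; rewrite -leqNgt.
have predS x : x \in S -> x != 0 -> x - r \in S.
  move=> xS x0; apply: contraNT x0 => xrS; apply/eqP.
  apply: (tight_pair_exit (tight_pair_neg tr)) => //; first exact: mem_S0.
  by rewrite add0r age1_not_opp.
pose Q : {set G} := [set r *+ (nat_of_ord i) | i : 'I_n].
have QS m : (m < n)%N -> r *+ m \in Q.
  by move=> mn; apply/imsetP; exists (Ordinal mn).
have n_gt0 : (0 < n)%N by case: n nS {nmin inS Q QS} => //; rewrite mulr0n mem_S0.
have SQ : S \subset Q.
  apply/subsetP=> x xS; apply: contraT => xQ; exfalso.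
  apply: (@no_periodic_subset (S :\: Q) (- r)).
  - by rewrite oppr_eq0.
  - by apply/set0Pn; exists x; rewrite in_setD xQ.
  - move=> y; rewrite in_setD => /andP[yQ /S_cases[y0|//]].
    by rewrite y0 -(mulr0n r) QS in yQ.
  - move=> y; rewrite !in_setD => /andP[yQ yS].
    rewrite predS ?andbT //; last first.
      by apply: contraNneq yQ => ->; rewrite -(mulr0n r) QS.
    apply: contraNN yQ => /imsetP[i _ /eqP]; rewrite subr_eq -mulrSr => /eqP yE.
    rewrite yE; apply: QS; rewrite ltn_neqAle ltn_ord andbT.
    by apply: contraNneq nS => <-; rewrite -yE.
have kn : (k < n)%N.
  rewrite -card_S -[leqRHS]card_ord; apply: leq_trans (subset_leq_card SQ) _.
  by rewrite leq_imset_card.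
have /S_cases[t0|//] := inS t (leq_ltn_trans tk kn).
exfalso; have /negP := age1_not_opp r1; apply.
suff -> : - r = r *+ t.-1 by apply: inS; lia.
by apply/eqP; rewrite eq_sym -subr_eq0 opprK -mulrSr prednK // t0.
Qed.
Section Progression.
Variable g : G.
Hypothesis age_g : forall t, (1 <= t <= k)%N -> age (g *+ t) = 1%N.

Definition progression m : {set G} := [set g *+ nat_of_ord t | t : 'I_m.+1].

Lemma progressionP m x :
  reflect (exists2 t, (t <= m)%N & x = g *+ t) (x \in progression m).
Proof.
apply: (iffP imsetP) => [[t _ ->]|[t tm ->]].
  by exists t => //; rewrite -ltnS.
by exists (Ordinal (tm : t < m.+1)%N).
Qed.

Lemma card_progression m : (#|progression m| <= m.+1)%N.
Proof. by apply: leq_trans (leq_imset_card _ _) _; rewrite card_ord. Qed.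

Lemma ages_upto_progression i : (i <= d)%N -> ages_upto i = progression (i * k).
Proof.
have g_inj : injective (fun t : 'I_k.+1 => g *+ nat_of_ord t).
  have lt t t' : (t < t' <= k)%N -> g *+ t <> g *+ t'.
    move=> tt' /eqP; rewrite eq_sym -subr_eq0 -mulrnBr; last by lia.
    by apply/negP/age1_neq0/age_g; lia.
  move=> t t' E; apply/val_inj; have := ltn_ord t; have := ltn_ord t'.
  case: (ltngtP t t') => // tt' l1 l2; exfalso; [apply: (@lt t t')|apply: (@lt t' t)] => //;
    by rewrite tt' -ltnS.
have SE : S = progression k.
  apply/esym/eqP; rewrite eqEcard card_S (card_imset _ g_inj) card_ord leqnn andbT.
  apply/subsetP=> x /progressionP[[|t] tk ->]; first by rewrite mulr0n mem_S0.
  by rewrite inE age_g.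
elim: i => [|i IH] id; apply/eqP; rewrite eqEcard card_ages_upto // addn1 card_progression andbT.
  apply/subsetP=> x; rewrite inE leqn0 => /eqP/age_eq0->.
  by apply/progressionP; exists 0%N; rewrite ?mulr0n.
rewrite -sumset_ages_uptoE // (IH (ltnW id)); apply/subsetP=> x /sumsetP[a [b []]].
rewrite -/S SE => /progressionP[t ti ->] /progressionP[t' tk ->] ->.
apply/progressionP; exists (t + t')%N; last by rewrite mulrnDr.
by rewrite mulSn addnC leq_add.
Qed.

Lemma g_inj t t' : (t < N)%N -> (t' < N)%N -> g *+ t = g *+ t' -> t = t'.
Proof.
have inj : {in predT &, injective (fun t : 'I_N => g *+ nat_of_ord t)}.
  apply/imset_injP; rewrite [eqbRHS]card_ord.
  have <- : progression (d * k) = [set g *+ nat_of_ord t | t : 'I_N].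
    apply/setP=> x; apply/progressionP/imsetP => [[s sd ->]|[s _ ->]].
      have sN : (s < N)%N by rewrite /N addn1.
      by exists (Ordinal sN).
    by exists s => //; rewrite -ltnS -[(d * k).+1]addn1 ltn_ord.
  by rewrite -ages_upto_progression // ages_upto_d card_G.
move=> tN tN' E.
by have := inj (Ordinal tN) (Ordinal tN'); move=> /(_ isT isT E) [].
Qed.

Lemma age_progression i t : (i <= d)%N -> (t < N)%N ->
  (age (g *+ t) <= i)%N = (t <= i * k)%N.
Proof.
move=> id tN; rewrite -mem_ages_upto ages_upto_progression //.
apply/progressionP/idP => [[s si /g_inj E]|ti]; last by exists t.
rewrite E //; apply: leq_ltn_trans si _.
by rewrite /N addn1 ltnS leq_mul2r id orbT.
Qed.

(** As A_i is the progression 0, g, .., i k g, ages go up by one every k steps. *)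
Lemma age_multiple i t : (i < d)%N -> (1 <= t <= k)%N ->
  age (g *+ (i * k + t)) = i.+1.
Proof.
move=> id /andP[t1 tk].
have iN : (i * k + t < N)%N.
  rewrite /N addn1 ltnS; apply: (@leq_trans (i.+1 * k)).
    by rewrite mulSn addnC leq_add2r.
  by rewrite leq_mul2r id orbT.
apply/eqP; rewrite eqn_leq; apply/andP; split.
  by rewrite age_progression // mulSn [leqRHS]addnC leq_add2l.
rewrite ltnNge age_progression ?(ltnW id) // -ltnNge.
by rewrite -[ltnLHS]addn0 ltn_add2l.
Qed.

Lemma mulg_N : g *+ N = 0.
Proof.
have: g *+ N \in ages_upto d by rewrite ages_upto_d inE.
rewrite ages_upto_progression // => /progressionP[[|t] td E].
  by rewrite E mulr0n.
have : (N.-1 = t)%N.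
  apply: g_inj; rewrite /N addn1 //=; first by rewrite ltnS ltnW.
  by apply: (addrI g); rewrite -!mulrS -addn1.
by rewrite /N addn1 /=; lia.
Qed.

Lemma c_mulrn j t : c j (g *+ t) = ((t * c j g) %% N)%N.
Proof.
elim: t => [|t IH]; first by rewrite mulr0n c0 mul0n mod0n.
by rewrite mulrS c_add IH modnDmr mulSn.
Qed.

Let h := g *+ k.

(** The ages of h, 2 h, .., d h are 1, 2, .., d, so no coordinate wraps around. *)
Lemma c_multiple_h i j : (i <= d)%N -> c j (h *+ i) = (i * c j h)%N.
Proof.
elim: i => [|i IH] id; first by rewrite mulr0n c0.
have hm m : h *+ m = g *+ (m * k) by rewrite mulnC mulrnA.
have ageh m : (m <= d)%N -> age (h *+ m) = m.
  case: m => [|m] md; first by rewrite mulr0n age0.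
  by rewrite hm mulSn addnC age_multiple // k_gt0 leqnn.
have ageh1 : age h = 1%N by apply: age_g; rewrite k_gt0 leqnn.
have E : age (h *+ i + h) = (age (h *+ i) + age h)%N.
  by rewrite -mulrSr (ageh _ id) (ageh _ (ltnW id)) ageh1 addn1.
by rewrite mulrSr (age_add_eq E) (IH (ltnW id)) mulSn addnC.
Qed.

(** The j-th coordinates a of g and m of k g satisfy a + d m = N, because g and
    d (k g) are opposite.  For t <= k the elements t g and (d - 1) k g have a sum
    of age d, so t a + (d - 1) m < N as long as t a does not wrap around; with
    1 < a < N / 2 this fails just before the first wrap-around. *)
Lemma c_g_cases j : c j g = 1%N \/ (N <= 2 * c j g)%N.
Proof.
have g1 : age g = 1%N by rewrite -[g]mulr1n age_g ?k_gt0.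
pose a := c j g; pose m := c j h.
have am : (a + d * m = N)%N.
  have -> : (d * m = c j (- g))%N.
    rewrite -c_multiple_h //; congr (c j _); apply/eqP.
    by rewrite eq_sym -subr_eq0 -opprD oppr_eq0 -mulrnA mulnC -mulrS -addn1 mulg_N.
  by rewrite c_pos_neg // age1_pos.
have a_gt0 : (0 < a)%N by apply: age1_pos.
have key t : (1 <= t <= k)%N -> (t * a < N)%N -> (t * a + d.-1 * m < N)%N.
  move=> tk taN; have <- : (c j (g *+ t) = t * a)%N by rewrite c_mulrn modn_small.
  rewrite -c_multiple_h ?leq_pred // -age_add_eq ?c_lt //.
  have hd : h *+ d.-1 = g *+ (d.-1 * k) by rewrite mulnC mulrnA.
  have d1 : (d.-1 < d)%N by case: (d) d_ge3.
  rewrite {1}hd addrC -mulrnDr age_multiple // age_g // hd.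
  have -> : (d.-1 * k = d.-2 * k + k)%N by case: (d) d_ge3 => [|[|e]] //= _; rewrite mulSn addnC.
  by rewrite age_multiple ?k_gt0 ?leqnn //; case: (d) d_ge3 => [|[|e]].
have [aN|aN] := leqP N (2 * a); first by right.
left; apply/eqP; rewrite eqn_leq a_gt0 andbT leqNgt; apply/negP => a1.
pose t := (N.-1 %/ a)%N.
have N0 := N_gt0.
have t2 : (2 <= t)%N by rewrite leq_divRL // -ltnS prednK.
have ta : (t * a < N)%N.
  by rewrite -[ltnRHS]prednK // ltnS leq_trunc_div.
have Nt : (N <= t.+1 * a)%N by rewrite -[leqLHS]prednK // ltn_ceil.
have [tk tam] := wrap_bound d_ge3 am a1 t2 ta Nt.
by move: tam; rewrite leqNgt key // tk ltnW.
Qed.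

End Progression.

(** The coordinates of g add up to N and are positive, so two of them cannot both
    be at least N / 2. *)
Theorem exists_unit_coordinates :
  exists g i0, age g = 1%N /\ forall j, j != i0 -> c j g = 1%N.
Proof.
have [g age_g] := exists_progression.
have g1 : age g = 1%N by rewrite -[g]mulr1n age_g ?k_gt0.
exists g; have sumg : (\sum_j c j g = N)%N by rewrite sum_c g1 muln1.
have [/existsP[i0 big0]|/existsPn none] := boolP [exists j, c j g != 1%N]; last first.
  by exists ord0; split=> // j _; have := none j; rewrite negbK => /eqP.
exists i0; split=> // j ji; apply/eqP; apply: contraT => bigj.
have big i : c i g != 1%N -> (N <= 2 * c i g)%N.
  by case: (c_g_cases age_g i) => // ->.
have /subsetPn[l _] : ~~ ([set: 'I_d.+1] \subset [set i0; j]).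
  apply/negP => /subset_leq_card; rewrite cardsT card_ord cards2.
  by rewrite leqNgt ltnS (leq_trans _ (ltnW d_ge3)) //; case: (i0 != j).
rewrite !inE negb_or => /andP[li lj].
have := sumg; rewrite (bigD1 i0) //= (bigD1 j) //= (bigD1 l) /=; last by rewrite li.
by have := big _ big0; have := big _ bigj; have := age1_pos g1 l; lia.
Qed.

End Age.
(** * A normal form for lattice simplices *)

Section Edges.
Variable d : nat.

Definition lattice_edges (v : 'I_d.+1 -> 'rV[int]_d) : 'M[int]_d :=
  \matrix_i (v (lift ord0 i) - v ord0).

(** Any difference of two vertices is an integer combination of the edges. *)
Lemma lattice_edges_comp (v : 'I_d.+1 -> 'rV[int]_d) (f : 'I_d.+1 -> 'I_d.+1) :
  exists Q : 'M[int]_d, lattice_edges (v \o f) = Q *m lattice_edges v.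
Proof.
pose e (j : 'I_d.+1) : 'rV[int]_d := oapp (fun i => delta_mx 0 i) 0 (unlift ord0 j).
have eE j : v j - v ord0 = e j *m lattice_edges v.
  case: (unliftP ord0 j) => [i ->|->]; rewrite /e ?liftK ?unlift_none /=.
    by rewrite -rowE rowK.
  by rewrite subrr mul0mx.
exists (\matrix_i (e (f (lift ord0 i)) - e (f ord0))).
apply/row_matrixP => i; rewrite rowK row_mul rowK mulmxBl -!eE /=.
by rewrite opprB addrA subrK.
Qed.

(** A permutation is invertible, so the integer matrices of lattice_edges_comp for
    it and its inverse have determinants of absolute value 1. *)
Lemma abs_det_lattice_edges_perm v (s : {perm 'I_d.+1}) :
  `|\det (lattice_edges (v \o s))| = `|\det (lattice_edges v)|.
Proof.
have [Q EQ] := lattice_edges_comp v s.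
have [Q' EQ'] := lattice_edges_comp (v \o s) (s^-1)%g.
have E : lattice_edges v = Q' *m lattice_edges (v \o s).
  rewrite -EQ'; congr lattice_edges; apply/funext => i /=.
  by rewrite permKV.
have [D0|D0] := eqVneq (\det (lattice_edges v)) 0.
  by rewrite EQ det_mulmx D0 mulr0.
have /(mulIf D0) : \det Q' * \det Q * \det (lattice_edges v) = 1 * \det (lattice_edges v).
  by rewrite -!det_mulmx -mulmxA -EQ -E mul1r.
move=> QQ; have uQ : \det Q \is a GRing.unit by apply/unitrP; exists (\det Q'); rewrite [_ * \det Q']mulrC.
rewrite EQ det_mulmx normrM; suff -> : `|\det Q| = 1 by rewrite mul1r.
by move: uQ; rewrite qualifE /= => /orP[] /eqP->.
Qed.
End Edges.

Section SimplexImages.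
Local Open Scope classical_set_scope.
Variables (R : realType) (d : nat).
Implicit Types (p q : 'I_d.+1 -> 'rV[R]_d).

Lemma simplex_perm p (s : {perm 'I_d.+1}) : simplex (p \o s) = simplex p.
Proof.
suff sub p' (s' : {perm 'I_d.+1}) : simplex (p' \o s') `<=` simplex p'.
  apply/seteqP; split; first exact: sub.
  have {1}-> : p = (p \o s) \o (s^-1)%g by apply/funext => i /=; rewrite permKV.
  exact: sub.
move=> x [w [w0 w1 ->]]; exists (w \o (s'^-1)%g); split=> [i|//|/=]; first exact: w0.
  by rewrite -w1 (reindex_perm s') /=; apply: eq_bigr => i _; rewrite permK.
by rewrite [RHS](reindex_perm s') /=; apply: eq_bigr => i _; rewrite permK.
Qed.

Lemma simplex_affine_image p (M : 'M[R]_d) (u : 'rV[R]_d) :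
  (fun x => x *m M + u) @` simplex p = simplex (fun i => p i *m M + u).
Proof.
have E w : \sum_i w i = 1 -> (\sum_i w i *: p i) *m M + u = \sum_i w i *: (p i *m M + u).
  move=> w1; under [RHS]eq_bigr do rewrite scalerDr.
  rewrite big_split /= -scaler_suml w1 scale1r mulmx_suml; congr (_ + _).
  by apply: eq_bigr => i _; rewrite scalemxAl.
apply/seteqP; split=> [_ [x [w [w0 w1 ->]] <-]|x [w [w0 w1 ->]]].
  by exists w; split=> //; rewrite E.
by exists (\sum_i w i *: p i); [exists w|rewrite E].
Qed.

End SimplexImages.

Section Unimodular.
Variables (d n : nat).

Definition T_apex : 'rV[int]_d.+1 :=
  \row_(j < d.+1) (if (j.+1 < d.+1)%N then n%:Z else (n + 1)%:Z).

Lemma T_vertex0 (a : 'rV[int]_d.+1) : T_vertex a ord0 = 0.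
Proof. by rewrite /T_vertex eqxx. Qed.

Lemma T_vertex_inner (a : 'rV[int]_d.+1) (i : 'I_d) :
  T_vertex a (lift ord0 (widen_ord (leqnSn d) i)) = delta_mx 0 (widen_ord (leqnSn d) i).
Proof.
rewrite /T_vertex /= /bump /= add1n ltnS ltn_ord.
by apply/rowP => j; rewrite !mxE eqxx /= -val_eqE eqSS.
Qed.

Lemma T_vertex_last (a : 'rV[int]_d.+1) : T_vertex a (lift ord0 ord_max) = a.
Proof. by rewrite /T_vertex /= /bump /= add1n ltnn. Qed.

Lemma det_T_edges : \det (lattice_edges (T_vertex T_apex)) = (n + 1)%:Z.
Proof.
rewrite det_trig.
  rewrite big_ord_recr /= big1 => [|i _]; rewrite mxE T_vertex0 subr0.
    by rewrite T_vertex_last mul1r mxE ltnn.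
  by rewrite T_vertex_inner mxE !eqxx.
apply/is_trig_mxP => i j ij; rewrite mxE T_vertex0 subr0.
have id : (i < d)%N by rewrite (leq_trans ij) // -ltnS.
have -> : i = widen_ord (leqnSn d) (Ordinal id) by apply/val_inj.
by rewrite T_vertex_inner mxE eqxx -val_eqE /= gtn_eqF.
Qed.

(** The edges w_1, .., w_d of a simplex with sum N z' are the image of the edges
    e_1, .., e_(d-1), a of T_a under the integer matrix with rows w_1, ..,
    w_(d-1) and z' - w_1 - .. - w_(d-1), since a = (N - 1, .., N - 1, N). *)
Lemma unimodular_edges (w : 'M[int]_d.+1) (z : 'rV[int]_d.+1) :
    `|\det w| = (n + 1)%:Z -> \sum_i row i w = z *+ (n + 1) ->
  exists M : 'M[int]_d.+1, (\det M = 1 \/ \det M = -1) /\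
    w = lattice_edges (T_vertex T_apex) *m M.
Proof.
move=> detw sumw.
pose inner := \sum_(i < d) row (widen_ord (leqnSn d) i) w.
pose M : 'M[int]_d.+1 :=
  \matrix_i (if (i < d)%N then row i w else z - inner).
have wE : w = lattice_edges (T_vertex T_apex) *m M.
  have M_inner i : row (widen_ord (leqnSn d) i) M = row (widen_ord (leqnSn d) i) w.
    by rewrite rowK /= ltn_ord.
  have M_last : row ord_max M = z - inner by rewrite rowK /= ltnn.
  apply/row_matrixP => i; rewrite row_mul rowK T_vertex0 subr0.
  have [id|di] := ltnP i d.
    have -> : i = widen_ord (leqnSn d) (Ordinal id) by apply/val_inj.
    by rewrite T_vertex_inner -rowE M_inner.
  have -> : i = ord_max by apply/val_inj/anti_leq; rewrite di -ltnS ltn_ord.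
  rewrite T_vertex_last mulmx_sum_row big_ord_recr /= M_last mxE ltnn.
  under eq_bigr do rewrite M_inner mxE /= ltnS ltn_ord.
  rewrite -scaler_sumr -/inner; move: sumw; rewrite big_ord_recr /= -/inner.
  move=> /(canRL (addKr _)) ->.
  rewrite PoszD scalerDl scale1r scalerBr [RHS]addrC.
  rewrite [RHS]addrAC subrK -natz scaler_nat mulrnDr mulr1n.
  by rewrite [LHS]addrC addrA.
exists M; split=> //.
have : `|\det M| = 1.
  have n0 : (n + 1)%:Z != 0 by rewrite addn1.
  apply: (mulfI n0); rewrite mulr1 -{2}detw wE det_mulmx normrM det_T_edges.
  by rewrite ger0_norm.
by case: (ger0P (\det M)) => _ E; [left|right; rewrite -E opprK].
Qed.

End Unimodular.

Section Conclusion.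
Local Open Scope classical_set_scope.
Variables (R : realType) (d n : nat) (v : 'I_d.+2 -> 'rV[int]_d.+1).
Hypothesis det_v : `|\det (lattice_edges v)| = (n + 1)%:Z.

(** The vertex i0 is moved to the front, since T_a has its first vertex at the
    origin; there the relation becomes that of unimodular_edges. *)
Lemma unimodular_of_relation (z : 'rV[int]_d.+1) (i0 : 'I_d.+2) :
    \sum_i (v i - v i0) = z *+ (n + 1) ->
  unimodularly_equivalent (lattice_simplex v : set 'rV[R]_d.+1)
    (T_simplex (T_apex d n)).
Proof.
move=> sumv; pose s := tperm ord0 i0; pose v' := v \o s.
have v'0 : v' ord0 = v i0 by rewrite /v' /= tpermL.
have [M [detM wE]] : exists M : 'M[int]_d.+1, (\det M = 1 \/ \det M = -1) /\
    lattice_edges v' = lattice_edges (T_vertex (T_apex d n)) *m M.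
  apply: (@unimodular_edges _ _ _ z); first by rewrite abs_det_lattice_edges_perm.
  rewrite -sumv [RHS](reindex_perm s) [RHS]big_ord_recl tpermL subrr [RHS]add0r.
  by apply: eq_bigr => i _; rewrite rowK v'0.
exists M, (v i0); split=> //.
rewrite /T_simplex /lattice_simplex simplex_affine_image -(simplex_perm _ s).
congr simplex; apply/funext => i; rewrite /= -/(v' i) /real_point -map_mxM -map_mxD.
congr map_mx; rewrite -v'0; case: (unliftP ord0 i) => [j ->|->].
  have /(congr1 (row j)) := wE; rewrite row_mul !rowK T_vertex0 subr0 => <-.
  by rewrite subrK.
by rewrite T_vertex0 mul0mx add0r.
Qed.

End Conclusion.
(** * The group of residues of barycentric coordinates *)

Section BoxGroup.
Variables (d N : nat) (W : 'M[int]_d).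

(** The group Z^d / Z^d W in barycentric disguise: its elements are the vectors x
    modulo N with x W = 0 modulo N, and x / N are the barycentric coordinates,
    modulo 1, of the lattice point x W / N. *)
Definition box_pred : {pred 'rV['Z_N]_d} := fun x => x *m map_mx intr W == 0.

Lemma box_pred_zmod_closed : zmod_closed box_pred.
Proof.
split=> [|x y]; rewrite !unfold_in ?mul0mx // => /eqP x0 /eqP y0.
by rewrite mulmxBl x0 y0 subrr.
Qed.

HB.instance Definition _ := GRing.isZmodClosed.Build _ box_pred box_pred_zmod_closed.

Record box := Box { box_val : 'rV['Z_N]_d; box_valP : box_val \in box_pred }.

HB.instance Definition _ := [isSub for box_val].
HB.instance Definition _ := [Finite of box by <:].
HB.instance Definition _ := [SubChoice_isSubZmodule of box by <:].

Hypothesis N_gt1 : (1 < N)%N.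

Lemma natr_Zp_eq0 (n : nat) : ((n%:R : 'Z_N) == 0) = (N %| n)%N.
Proof. by rewrite -val_eqE /= val_Zp_nat. Qed.

Lemma intr_Zp_eq0 (m : int) : ((m%:~R : 'Z_N) == 0) = (N %| m)%Z.
Proof.
case: m => n; first exact: natr_Zp_eq0.
by rewrite NegzE mulrNz oppr_eq0 dvdzE abszN; exact: natr_Zp_eq0.
Qed.

(** A divisor e of N kills exactly e residues, the multiples of N / e. *)
Lemma card_Zp_annihilator (e : nat) : (e %| N)%N ->
  #|[set a : 'Z_N | a *+ e == 0]| = e.
Proof.
case/dvdnP=> q Nqe.
have qe_gt0 : (0 < q * e)%N by rewrite -Nqe ltnW.
have /andP[q_gt0 e_gt0] : (0 < q)%N && (0 < e)%N by rewrite -muln_gt0.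
pose f (i : 'I_e) : 'Z_N := (q * i)%:R.
have lt_qi (i : 'I_e) : (q * i < N)%N by rewrite Nqe ltn_pmul2l.
have f_val i : f i = (q * i)%N :> nat by rewrite val_Zp_nat // modn_small.
have f_inj : injective f.
  move=> i j /(congr1 val) /=; rewrite !f_val => /eqP.
  by rewrite eqn_pmul2l // => /eqP/val_inj.
rewrite -[RHS]card_ord -(card_imset _ f_inj); apply: eq_card => a; rewrite inE.
apply/idP/imsetP => [|[i _ ->]]; last first.
  rewrite -mulrnA -val_eqE /= val_Zp_nat // mulnAC -Nqe.
  by rewrite modnMr.
rewrite -[a in a *+ e]natr_Zp -mulrnA -val_eqE /= val_Zp_nat // => ae0.
have : (q * e %| a * e)%N by rewrite /dvdn -Nqe.
rewrite dvdn_pmul2r // => /dvdnP[i ai].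
have ie : (i < e)%N.
  have aN : (a < N)%N by rewrite -[ltnRHS](Zp_cast N_gt1) ltn_ord.
  by rewrite -(ltn_pmul2l q_gt0) -Nqe mulnC -ai.
exists (Ordinal ie) => //; apply/val_inj; rewrite /= f_val /= ai.
by rewrite mulnC.
Qed.

Lemma int_unitmx_mod m (L : 'M[int]_m) :
  L \in unitmx -> (map_mx intr L : 'M['Z_N]_m) \in unitmx.
Proof. by rewrite !unitmxE det_map_mx; apply: rmorph_unit. Qed.

(** The Smith normal form reduces the count to a diagonal matrix, where it is done
    coordinatewise; its entries divide N because their product is N up to sign. *)
Lemma card_box : `|\det W|%N = N -> #|[set: box]| = N.
Proof.
move=> detW.
have [L uL [Rm uR [s _ WE]]] := int_Smith_normal_form W.
pose D : 'M[int]_d := \matrix_(i, j) (s`_i *+ (i == j :> nat)).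
have DE : D = diag_mx (\row_i s`_i).
  by apply/matrixP => i j; rewrite !mxE.
have detD : (\prod_(i < d) absz (s`_i)%R)%N = N.
  have unit1 (m : int) : m \is a GRing.unit -> `|m|%N = 1%N by move=> /orP[] /eqP->.
  rewrite unitmxE in uL; rewrite unitmxE in uR.
  have -> : N = `|\det D|%N.
    by rewrite -detW WE !det_mulmx !abszM (unit1 _ uL) (unit1 _ uR) mul1n muln1.
  rewrite DE det_diag (big_morph _ abszM (erefl _)).
  by apply: eq_bigr => i _; rewrite mxE.
pose Lm : 'M['Z_N]_d := map_mx intr L.
have uLm : Lm \in unitmx by apply: int_unitmx_mod.
pose Rmod : 'M['Z_N]_d := map_mx intr Rm.
have uRm : Rmod \in unitmx by apply: int_unitmx_mod.
pose F (i : 'I_d) : {set 'Z_N} := [set a : 'Z_N | a *+ absz s`_i == 0].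
have mulr_intr_eq0 (a : 'Z_N) (m : int) : (a * m%:~R == 0) = (a *+ `|m|%N == 0).
  by case: m => n; rewrite ?NegzE ?mulrNz ?mulrN ?oppr_eq0 -mulr_natr.
have memE x : (x \in box_pred) = [forall i, (x *m Lm) 0 i \in F i].
  rewrite unfold_in WE !map_mxM /= !mulmxA -/D DE map_diag_mx.
  rewrite -/Rmod -[X in _ == X](mul0mx _ Rmod) (inj_eq (can_inj (mulmxK uRm))).
  apply/eqP/forallP => [x0 i|x0]; last apply/rowP => i.
    by have /rowP/(_ i) := x0; rewrite inE -mulr_intr_eq0 mul_mx_diag !mxE => ->.
  by have := x0 i; rewrite inE -mulr_intr_eq0 mul_mx_diag !mxE => /eqP.
pose g (x : 'rV['Z_N]_d) : {ffun 'I_d -> 'Z_N} := [ffun i => (x *m Lm) 0 i].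
have g_inj : injective g.
  move=> x y /ffunP gxy; apply: (can_inj (mulmxK uLm)); apply/rowP => i.
  by have := gxy i; rewrite !ffunE.
have memg x : (x \in box_pred) = (g x \in family F).
  rewrite memE; apply: eq_forallb => i; by rewrite ffunE.
rewrite cardsT card_sub -[LHS](fintype.card_image g_inj).
transitivity #|family F|.
  apply: eq_card => h; apply/fintype.imageP/idP => [[x xB ->]|hF]; first by rewrite -memg.
  pose x := (\row_i h i) *m invmx Lm.
  have xL : x *m Lm = \row_i h i by exact: (mulmxKV uLm (\row_i h i)).
  have gx : g x = h by apply/ffunP => i; rewrite ffunE xL mxE.
  by exists x => //; change (x \in box_pred); rewrite memg gx.
rewrite card_family foldrE big_image /= -[RHS]detD.
apply: eq_bigr => i _; apply: card_Zp_annihilator.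
by rewrite -[X in (_ %| X)%N]detD (bigD1 i) //= dvdn_mulr.
Qed.

(** Barycentric coordinates add up to an integer, which forces the one at v_0. *)
Definition box_coord (j : 'I_d.+1) (x : box) : 'Z_N :=
  oapp (box_val x 0) (- \sum_i box_val x 0 i) (unlift ord0 j).

Lemma box_coordD j x y : box_coord j (x + y) = box_coord j x + box_coord j y.
Proof.
rewrite /box_coord; case: unliftP => [i|] _ /=; first by rewrite mxE.
by rewrite -opprD -big_split; congr (- _); apply: eq_bigr => i _; rewrite mxE.
Qed.

Lemma sum_box_coord x : \sum_j box_coord j x = 0.
Proof.
rewrite big_ord_recl /box_coord unlift_none /=.
rewrite [X in _ + X](eq_bigr (box_val x 0)) ?addNr // => i _.
by rewrite fintype.liftK.
Qed.

Lemma box_coord_inj x y : (forall j, box_coord j x = box_coord j y) -> x = y.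
Proof.
move=> xy; apply/val_inj/rowP => i.
by have := xy (lift ord0 i); rewrite /box_coord fintype.liftK.
Qed.

Definition box_nat (j : 'I_d.+1) (x : box) : nat := box_coord j x.

Definition box_age (x : box) : nat := ((\sum_j box_nat j x) %/ N)%N.

Lemma box_nat_lt j x : (box_nat j x < N)%N.
Proof. by rewrite -[ltnRHS](Zp_cast N_gt1) ltn_ord. Qed.

Lemma box_natD j x y : box_nat j (x + y) = ((box_nat j x + box_nat j y) %% N)%N.
Proof.
by rewrite /box_nat box_coordD /=; congr (_ %% _)%N; apply: Zp_cast.
Qed.

Lemma box_nat_inj x y : (forall j, box_nat j x = box_nat j y) -> x = y.
Proof. by move=> xy; apply: box_coord_inj => j; apply/val_inj; apply: xy. Qed.

Lemma box_nat0 j : box_nat j 0 = 0%N.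
Proof.
have := box_coordD j 0 0; rewrite addr0 -[LHS]addr0 => /addrI coord0.
by rewrite /box_nat -coord0.
Qed.

Lemma sum_box_nat x : (\sum_j box_nat j x = N * box_age x)%N.
Proof.
rewrite /box_age mulnC divnK // -natr_Zp_eq0 natr_sum.
by under eq_bigr do rewrite natr_Zp; rewrite sum_box_coord.
Qed.

End BoxGroup.
(** * Linear changes of variables for Lebesgue measure *)

Local Open Scope classical_set_scope.

(** Product measures are formed from elements of the sigma-finite structure. *)
Section SigmaFinitePack.
Context dT (T : measurableType dT) (R : realType).
Variable m : {measure set T -> \bar R}.
Hypothesis m_sigma_finite : sigma_finite setT m.

Let m' : set T -> \bar R := m.

HB.instance Definition _ := Measure.on m'.
HB.instance Definition _ := Measure_isSigmaFinite.Build _ _ _ m' m_sigma_finite.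

Lemma sigma_finite_pack :
  exists mu : {sigma_finite_measure set T -> \bar R}, (mu : set T -> \bar R) = m.
Proof. by exists m'. Qed.

End SigmaFinitePack.

Lemma product_sigma_finite d1 d2 (T1 : measurableType d1)
    (T2 : measurableType d2) (R : realType)
    (m1 : {sigma_finite_measure set T1 -> \bar R})
    (m2 : {sigma_finite_measure set T2 -> \bar R}) :
  exists2 F : (set (T1 * T2))^nat, setT = \bigcup_i F i &
    forall i, measurable (F i) /\ ((m1 \x m2)%E (F i) < +oo)%E.
Proof.
have /sigma_finiteP[F [FT Fnd Foo]] := sigma_finiteT m1.
have /sigma_finiteP[G [GT Gnd Goo]] := sigma_finiteT m2.
exists (fun n => F n `*` G n).
  apply/esym; rewrite -subTset => -[x y] _.
  have [n _ Fx] : (\bigcup_i F i) x by rewrite -FT.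
  have [m _ Gy] : (\bigcup_i G i) y by rewrite -GT.
  exists (maxn n m) => //; split.
    by move/subsetPset: (Fnd _ _ (leq_maxl n m)); apply.
  by move/subsetPset: (Gnd _ _ (leq_maxr n m)); apply.
move=> n; have [mF Fn] := Foo n; have [mG Gn] := Goo n.
split; first exact: measurableX.
by rewrite product_measure1E// lte_mul_pinfty// ge0_fin_numE.
Qed.

Section LebesgueTuple.
Variable R : realType.
Implicit Types d : nat.

Local Notation tupleR d := (d.-tuple (measurableTypeR R)).
Local Notation leb := (@lebesgue_measure R).

Definition cons_pair d (p : measurableTypeR R * tupleR d) : tupleR d.+1 :=
  [tuple of p.1 :: p.2].

Definition uncons_pair d (t : tupleR d.+1) : measurableTypeR R * tupleR d :=
  (thead t, [tuple of behead t]).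

Lemma cons_pairK d : cancel (@cons_pair d) (@uncons_pair d).
Proof.
by case=> x t; rewrite /uncons_pair /cons_pair /=; congr (_, _); apply/val_inj.
Qed.

Lemma measurable_cons_pair d : measurable_fun setT (@cons_pair d).
Proof. exact: measurable_cons. Qed.

Lemma measurable_uncons_pair d : measurable_fun setT (@uncons_pair d).
Proof.
by apply: measurable_fun_pair; [apply: measurable_tnth|apply: measurable_behead].
Qed.

(** The product measure of the inductive step is only available once the previous
    stage is known to be a measure, and is again sigma-finite; hence both facts are
    established together. *)
Lemma lebesgue_tuple_exists d :
  exists mu : {sigma_finite_measure set (tupleR d) -> \bar R},
    (mu : set (tupleR d) -> \bar R) = @lebesgue_tuple R d.
Proof.
elim: d => [|d [mu muE]].
  by exists (@dirac _ (tupleR 0) [tuple] R : {sigma_finite_measure set _ -> \bar R}).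
pose m : {measure set (tupleR d.+1) -> \bar R} :=
  measure_function_pushforward__canonical__measure_function_Measure
    (leb \x mu)%E (@measurable_cons_pair d).
have [mu' mu'E] : exists mu' : {sigma_finite_measure set (tupleR d.+1) -> \bar R},
    (mu' : set _ -> \bar R) = m.
  apply: sigma_finite_pack.
  have [F FT Foo] := product_sigma_finite leb mu.
  exists (fun i => @uncons_pair d @^-1` F i).
    by rewrite -preimage_bigcup -FT preimage_setT.
  move=> i; have [mF Fi] := Foo i; split.
    by rewrite -[X in measurable X]setTI; apply: measurable_uncons_pair.
  rewrite /m /= /pushforward -comp_preimage.
  suff -> : @uncons_pair d \o @cons_pair d = id by [].
  by apply/funext => p /=; rewrite cons_pairK.
by exists mu'; rewrite mu'E /m /= -muE.
Qed.
Lemma lebesgue_tuple_set0 d : @lebesgue_tuple R d set0 = 0%E.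
Proof. by have [mu <-] := lebesgue_tuple_exists d; apply: measure0. Qed.

Lemma lebesgue_tuple_ge0 d A : (0 <= @lebesgue_tuple R d A)%E.
Proof. by have [mu <-] := lebesgue_tuple_exists d; apply: measure_ge0. Qed.

Lemma lebesgue_tuple_sigma_additive d : semi_sigma_additive (@lebesgue_tuple R d).
Proof.
by have [mu <-] := lebesgue_tuple_exists d; apply: measure_semi_sigma_additive.
Qed.

HB.instance Definition _ d := isMeasure.Build _ _ _ (@lebesgue_tuple R d)
  (lebesgue_tuple_set0 d) (@lebesgue_tuple_ge0 d) (@lebesgue_tuple_sigma_additive d).

Lemma lebesgue_tuple_sigma_finite d : sigma_finite setT (@lebesgue_tuple R d).
Proof. by have [mu <-] := lebesgue_tuple_exists d; apply: sigma_finiteT. Qed.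

HB.instance Definition _ d := Measure_isSigmaFinite.Build _ _ _
  (@lebesgue_tuple R d) (@lebesgue_tuple_sigma_finite d).

Lemma lebesgue_tupleS_swap d A : measurable A ->
  @lebesgue_tuple R d.+1 A =
  (\int[@lebesgue_tuple R d]_y leb (ysection (@cons_pair d @^-1` A) y))%E.
Proof.
move=> mA; pose leb2 : {measure set (measurableTypeR R * tupleR d)%type -> \bar R} :=
  (leb \x^ @lebesgue_tuple R d)%E.
have mA' : measurable (@cons_pair d @^-1` A).
  by rewrite -[X in measurable X]setTI; apply: measurable_cons_pair.
have := @product_measure_unique _ _ _ _ R leb (@lebesgue_tuple R d) leb2.
move=> /(_ _ _ mA'); apply => B C mB mC.
exact: product_measure2E.
Qed.

Definition affine1 (a b x : R) : R := a * x + b.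

Lemma measurable_affine1 a b :
  measurable_fun setT (affine1 a b : measurableTypeR R -> measurableTypeR R).
Proof.
by apply: (@measurable_funD _ _ R _ ( *%R a) (cst b)) => //; exact: measurable_cst.
Qed.

(** Lebesgue measure is determined by its values on intervals.  For a < 0 the
    preimage of a half-open interval is half-open on the other side. *)
Lemma lebesgue_affine1 a b (A : set (measurableTypeR R)) : a != 0 -> measurable A ->
  leb A = (`|a|%:E * leb (affine1 a b @^-1` A))%E.
Proof.
move=> a0 mA.
pose push := measure_function_pushforward__canonical__measure_function_Measure
  leb (measurable_affine1 a b).
pose mu : {measure set (measurableTypeR R) -> \bar R} := mscale (NngNum (normr_ge0 a)) push.
apply: (@lebesgue_measure_unique R mu _ A mA) => _ [[c e] _ <-] /=.
rewrite /mu /mscale /= /pushforward.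
have [a_gt0|a_lt0|a00] := ltgtP 0 a; last by rewrite -a00 eqxx in a0.
  have -> : affine1 a b @^-1` `]c, e] = `]((c - b) / a), ((e - b) / a)].
    apply/seteqP; split => x /=; rewrite !in_itv /= /affine1 ltr_pdivrMr // ler_pdivlMr //;
      by rewrite ltrBlDr lerBrDr mulrC.
  rewrite !lebesgue_measure_itv /= !lte_fin ltr_pM2r ?invr_gt0 // ltrD2r gtr0_norm //.
  by case: ifP => _; rewrite ?mule0 // -!EFinD -EFinM; congr EFin; field.
have -> : affine1 a b @^-1` `]c, e] = `[((e - b) / a), ((c - b) / a)[.
  apply/seteqP; split => x /=; rewrite !in_itv /= /affine1 ltr_ndivlMr // ler_ndivrMr //;
    by rewrite ltrBlDr lerBrDr mulrC andbC.
rewrite !lebesgue_measure_itv /= !lte_fin ltr_nM2r ?invr_lt0 // ltrD2r ltr0_norm //.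
by case: ifP => _; rewrite ?mule0 // -!EFinD -EFinM; congr EFin; field.
Qed.

Lemma ge0_integral_affine1 a b (f : measurableTypeR R -> \bar R) : a != 0 ->
    measurable_fun setT f -> (forall x, 0 <= f x)%E ->
  (\int[leb]_x f x = `|a|%:E * \int[leb]_x f (affine1 a b x))%E.
Proof.
move=> a0 mf f0.
pose push := measure_function_pushforward__canonical__measure_function_Measure
  leb (measurable_affine1 a b).
transitivity (\int[mscale (NngNum (normr_ge0 a)) push]_x f x)%E.
  by apply: eq_measure_integral => A mA _; apply: lebesgue_affine1.
rewrite ge0_integral_mscale //=; congr (_ * _)%E.
by rewrite ge0_integral_pushforward //; exact: measurable_affine1.
Qed.

Definition row_of_tuple d (t : tupleR d) : 'rV[R]_d := \row_i tnth t i.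

Definition measurable_rV d (A : set 'rV[R]_d) :=
  measurable (@row_of_tuple d @^-1` A).

Lemma row_of_tuple_cons d x (t : tupleR d) :
  row_of_tuple (cons_pair (x, t)) = row_mx (const_mx x) (row_of_tuple t) :> 'rV_(1 + d).
Proof.
apply/rowP => i; rewrite /row_of_tuple mxE; case: (@split_ordP 1 d i) => j ->.
  by rewrite row_mxEl mxE ord1.
by rewrite row_mxEr mxE -(tnthS x t j); congr tnth; apply/val_inj.
Qed.

(** Integration over slices with a fixed first coordinate. *)
Lemma VolS d (A : set 'rV[R]_(1 + d)) :
  Vol (A : set 'rV[R]_d.+1) =
  (\int[leb]_x Vol [set y | A (row_mx (const_mx x) y)])%E.
Proof.
rewrite /Vol /= /pushforward /product_measure1; apply: eq_integral => x _ /=.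
congr (lebesgue_tuple _); apply/funext => t; rewrite /xsection /= in_setE.
exact: (congr1 A (row_of_tuple_cons x t)).
Qed.

(** The other order of integration: slices along the first coordinate. *)
Lemma VolS_swap d (A : set 'rV[R]_(1 + d)) : measurable_rV (A : set 'rV[R]_d.+1) ->
  Vol (A : set 'rV[R]_d.+1) = (\int[@lebesgue_tuple R d]_t
    leb [set x | A (row_mx (const_mx x) (row_of_tuple t))])%E.
Proof.
move=> mA; rewrite /Vol lebesgue_tupleS_swap //; apply: eq_integral => t _.
congr (leb _); apply/funext => x; rewrite /ysection /= in_setE.
exact: (congr1 A (row_of_tuple_cons x t)).
Qed.

Lemma measurable_uncurried d (A : set 'rV[R]_(1 + d)) :
  measurable_rV (A : set 'rV[R]_d.+1) ->
  measurable [set p : measurableTypeR R * tupleR d |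
               A (row_mx (const_mx p.1) (row_of_tuple p.2))].
Proof.
move=> mA; rewrite [X in measurable X](_ : _ =
  @cons_pair d @^-1` (@row_of_tuple d.+1 @^-1` A)).
  by rewrite -[X in measurable X]setTI; apply: measurable_cons_pair.
by apply/funext => -[x t]; exact: (esym (congr1 A (row_of_tuple_cons x t))).
Qed.

Lemma measurable_slice d (A : set 'rV[R]_(1 + d)) x :
  measurable_rV (A : set 'rV[R]_d.+1) ->
  measurable_rV [set y | A (row_mx (const_mx x) y)].
Proof.
move=> /measurable_uncurried /(measurable_xsection x).
by congr measurable; apply/funext => t; rewrite /xsection /= in_setE.
Qed.

Lemma measurable_slice_swap d (A : set 'rV[R]_(1 + d)) y :
  measurable_rV (A : set 'rV[R]_d.+1) ->
  measurable ([set x | A (row_mx (const_mx x) (row_of_tuple y))] : set (measurableTypeR R)).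
Proof.
move=> /measurable_uncurried /(measurable_ysection y).
by congr measurable; apply/funext => x; rewrite /ysection /= in_setE.
Qed.

Lemma measurable_fun_Vol_slice d (A : set 'rV[R]_(1 + d)) :
  measurable_rV (A : set 'rV[R]_d.+1) ->
  measurable_fun setT (fun x : measurableTypeR R => Vol [set y | A (row_mx (const_mx x) y)]).
Proof.
move=> /measurable_uncurried /(measurable_fun_xsection (@lebesgue_tuple R d)).
congr measurable_fun; apply/funext => x /=; congr lebesgue_tuple.
by apply/funext => t; rewrite /xsection /= in_setE.
Qed.

Lemma measurable_affine_preimage m d (M : 'M[R]_(m, d)) (q : 'rV[R]_d) (A : set 'rV[R]_d) :
  measurable_rV A -> measurable_rV [set x | A (x *m M + q)].
Proof.
move=> mA; pose f (t : tupleR m) : tupleR d := [tuple (row_of_tuple t *m M + q) 0 i | i < d].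
have mf : measurable_fun setT f.
  apply/measurable_fun_tnthP => i.
  rewrite (_ : _ \o _ = (fun t : tupleR m => (\sum_j tnth t j * M j i) + q 0 i)).
    apply: measurable_funD; last exact: measurable_cst.
    apply: measurable_sum => j; apply: measurable_funM; last exact: measurable_cst.
    exact: measurable_tnth.
  apply/funext => t /=; rewrite tnth_mktuple !mxE; congr (_ + _).
  by apply: eq_bigr => j _; rewrite mxE.
have -> : @measurable_rV m [set x | A (x *m M + q)] =
    measurable (setT `&` f @^-1` (@row_of_tuple d @^-1` A)).
  rewrite setTI /measurable_rV; congr measurable; apply/seteqP.
  have E t : row_of_tuple (f t) = row_of_tuple t *m M + q.
    by apply/rowP => i; rewrite mxE tnth_mktuple.
  by split => t /=; rewrite E.
exact: mf.
Qed.

Lemma measurable_linear_preimage m d (M : 'M[R]_(m, d)) (A : set 'rV[R]_d) :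
  measurable_rV A -> measurable_rV [set x | A (x *m M)].
Proof.
move=> /(measurable_affine_preimage M 0); congr measurable_rV.
by apply/seteqP; split => x /=; rewrite addr0.
Qed.

Lemma measurable_translate_preimage d q (A : set 'rV[R]_d) :
  measurable_rV A -> measurable_rV [set x | A (x + q)].
Proof.
move=> /(measurable_affine_preimage 1%:M q); congr measurable_rV.
by apply/seteqP; split => x /=; rewrite mulmx1.
Qed.

Lemma Vol_translate d q (A : set 'rV[R]_d) : measurable_rV A ->
  Vol [set x | A (x + q)] = Vol A.
Proof.
elim: d => [|d IH] in q A *.
  by move=> _; rewrite (thinmx0 q); congr Vol; apply/seteqP; split => x /=; rewrite addr0.
move=> mA; rewrite [RHS]VolS (@ge0_integral_affine1 1 ((q : 'rV_(1 + d)) 0 0)) ?oner_eq0 //;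
  last exact: measurable_fun_Vol_slice.
rewrite normr1 mul1e VolS; apply: eq_integral => x _ /=.
rewrite -[RHS](IH (@rsubmx _ 1 1 d q)); last exact: measurable_slice.
congr Vol; apply/funext => y; rewrite /affine1 mul1r; apply: (congr1 A).
apply/rowP => i; rewrite mxE; case: (@split_ordP 1 d i) => j ->.
  by rewrite !(@row_mxEl _ 1 1 d) !mxE !ord1; congr (_ + q _ _); apply/val_inj.
by rewrite !(@row_mxEr _ 1 1 d) !mxE.
Qed.

(** Preimages, unlike images, are measurable for every M and compatible with
    slices. *)
Definition vol_scales d (M : 'M[R]_d) := forall A : set 'rV[R]_d, measurable_rV A ->
  Vol A = (`|\det M|%:E * Vol [set x | A (x *m M)])%E.

Lemma vol_scales_mul d (M N : 'M[R]_d) :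
  vol_scales M -> vol_scales N -> vol_scales (M *m N).
Proof.
move=> sM sN A mA; rewrite (sN A mA) (sM [set x | A (x *m N)]).
  rewrite muleA -EFinM det_mulmx normrM mulrC; congr (_ * Vol _)%E.
  by apply/seteqP; split => x /=; rewrite mulmxA.
exact: measurable_linear_preimage.
Qed.

(** Each slice with a fixed first coordinate is translated. *)
Lemma vol_scales_upper d (u : 'rV[R]_d) :
  @vol_scales (1 + d) (block_mx 1 u 0 1%:M).
Proof.
move=> A mA; rewrite det_ublock !det1 mulr1 normr1 mul1e [LHS]VolS [RHS]VolS.
apply: eq_integral => x _; rewrite -[LHS](Vol_translate (const_mx x *m u)); last first.
  exact: measurable_slice.
congr Vol; apply/funext => y; apply: (congr1 A).
by rewrite (@mul_row_block _ 1 1 d 1 d) !mulmx1 mulmx0 addr0 addrC.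
Qed.

(** Each slice along the first coordinate is translated. *)
Lemma vol_scales_lower d (c : 'cV[R]_d) :
  @vol_scales (1 + d) (block_mx 1 0 c 1%:M).
Proof.
move=> A mA; rewrite det_lblock !det1 mulr1 normr1 mul1e.
rewrite [LHS]VolS_swap // [RHS]VolS_swap; last exact: measurable_linear_preimage.
apply: eq_integral => t _; pose b := (row_of_tuple t *m c) 0 0.
rewrite (@lebesgue_affine1 1 b) ?oner_eq0 //; last exact: measurable_slice_swap.
rewrite normr1 mul1e; congr (leb _); apply/funext => x; apply: (congr1 A).
rewrite (@mul_row_block _ 1 1 d 1 d) !mulmx1 mulmx0 add0r /affine1 mul1r.
by congr row_mx; apply/matrixP => i j; rewrite !ord1 mxE [RHS]mxE [X in _ = X + _]mxE.
Qed.

Lemma vol_scales_diag d (a : R) (M : 'M[R]_d) : a != 0 -> vol_scales M ->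
  @vol_scales (1 + d) (block_mx a%:M 0 0 M).
Proof.
move=> a0 sM A mA; rewrite det_ublock det_scalar1 normrM.
rewrite [LHS]VolS (@ge0_integral_affine1 a 0) //;
  last exact: measurable_fun_Vol_slice.
rewrite EFinM -muleA; congr (_ * _)%E; rewrite [in RHS]VolS.
rewrite -ge0_integralZl //; last first.
  apply: (@measurable_fun_Vol_slice d [set x | A (x *m block_mx a%:M 0 0 M)]).
  exact: measurable_linear_preimage.
apply: eq_integral => x _; rewrite sM; last exact: measurable_slice.
congr (_ * Vol _)%E; apply/funext => y; apply: (congr1 A).
rewrite (@mul_row_block _ 1 1 d 1 d) !mulmx0 addr0 add0r /affine1 addr0.
by congr row_mx; apply/matrixP => i j; rewrite !ord1 mul_mx_scalar !mxE.
Qed.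

(** Gaussian elimination: after a shear that makes the top left entry nonzero,
    the matrix is a product of a lower triangular shear, a block diagonal matrix
    and an upper triangular shear. *)
Theorem vol_scales_unit d (M : 'M[R]_d) : M \in unitmx -> vol_scales M.
Proof.
elim: d M => [|d IH] M uM.
  move=> A mA; rewrite det_mx00 normr1 mul1e; congr Vol.
  by apply/seteqP; split => x /=; rewrite (flatmx0 M) (thinmx0 x) mulmx0 //.
have pivot (N : 'M[R]_(1 + d)) : N \in unitmx -> N 0 0 != 0 -> vol_scales N.
  move=> uN; set a := N 0 0 => a0.
  pose D := drsubmx N - a^-1 *: (dlsubmx N *m ursubmx N).
  have NE : N = block_mx 1 0 (a^-1 *: dlsubmx N) 1%:M *m block_mx a%:M 0 0 D *m
                block_mx 1 (a^-1 *: ursubmx N) 0 1%:M.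
    have aE : ulsubmx N = a%:M.
      by apply/matrixP => i j; rewrite !ord1 !mxE /= /a; congr (N _ _); apply/val_inj.
    rewrite !mulmx_block !mulmx0 !mul0mx !mulmx1 !mul1mx !addr0 !add0r.
    rewrite -[LHS]submxK aE; congr block_mx.
    - by rewrite mul_scalar_mx scalerA divff // scale1r.
    - by rewrite mul_mx_scalar scalerA divff // scale1r.
    - rewrite mul_mx_scalar scalerA divff // scale1r -scalemxAr.
      by rewrite /D addrC subrK.
  rewrite NE; apply: vol_scales_mul; last exact: vol_scales_upper.
  apply: vol_scales_mul; first exact: vol_scales_lower.
  apply: vol_scales_diag => //; apply: IH.
  move: uN; rewrite NE !unitmx_mul => /andP[/andP[_ + ] _].
  by rewrite !unitmxE det_ublock unitrM => /andP[].
have [i Mi0] : exists i, M i 0 != 0.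
  apply/existsP; apply: contraLR uM; rewrite negb_exists => /forallP M0.
  rewrite unitmxE -det_tr (expand_det_row _ 0) big1 ?unitr0 // => j _.
  by have := M0 j; rewrite negbK mxE => /eqP->; rewrite mul0r.
have [M00|M00] := eqVneq (M 0 0) 0; last exact: (pivot M).
have [j ij] : exists j : 'I_d, i = rshift 1 j.
  case: (@split_ordP 1 d i) Mi0 => j ->; last by exists j.
  by rewrite (_ : lshift d j = 0) ?M00 ?eqxx //; apply/val_inj; rewrite /= ord1.
pose E (v : 'rV[R]_d) : 'M[R]_(1 + d) := block_mx 1 v 0 1%:M.
pose u : 'rV[R]_d := delta_mx 0 j.
have uE : E u \in unitmx by rewrite unitmxE det_ublock !det1 mulr1 unitr1.
have -> : M = E (- u) *m (E u *m M).
  rewrite mulmxA mulmx_block !mulmx0 !mul0mx !mulmx1 !mul1mx !addr0 !add0r subrr.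
  by rewrite -scalar_mx_block mul1mx.
apply: vol_scales_mul; first exact: vol_scales_upper.
apply: pivot; first by rewrite unitmx_mul uE.
have Eu l : E u 0 (rshift 1 l) = u 0 l.
  rewrite (_ : 0 = lshift d 0 :> 'I_(1 + d)); first exact: block_mxEur.
  exact/val_inj.
suff -> : (E u *m M) 0 0 = M i 0 by [].
rewrite mxE big_split_ord /= big_ord1 (_ : lshift d 0 = 0); last exact/val_inj.
rewrite M00 mulr0 add0r (bigD1 j) //= big1 => [|l lj].
  by rewrite addr0 Eu mxE !eqxx mul1r -ij.
by rewrite Eu mxE (negPf lj) andbF mul0r.
Qed.
(** * Simplices and barycentric coordinates *)

Definition corner_simplex d (s : R) : set 'rV[R]_d :=
  [set y | (forall i, 0 <= y 0 i) /\ \sum_i y 0 i <= s].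

Lemma measurable_corner_simplex d s : measurable_rV (@corner_simplex d s).
Proof.
pose nonneg i : set (tupleR d) := (fun t => tnth t i) @^-1` `[0, +oo[.
pose sum_le : set (tupleR d) := (fun t => \sum_i tnth t i) @^-1` `]-oo, s].
rewrite /measurable_rV (_ : _ @^-1` _ = (\bigcap_(i in [set: 'I_d]) nonneg i) `&` sum_le).
  apply: measurableI.
    apply: fin_bigcap_measurable => // i _.
    by rewrite -[X in measurable X]setTI; apply: measurable_tnth.
  rewrite -[X in measurable X]setTI.
  have msum : measurable_fun setT (fun t : tupleR d => \sum_i tnth t i : R).
    by apply: measurable_sum => i; exact: measurable_tnth.
  exact: msum.
have sumE t : \sum_i row_of_tuple t 0 i = \sum_i tnth t i.
  by apply: eq_bigr => i _; rewrite mxE.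
apply/seteqP; split => t /=; rewrite /corner_simplex /= sumE.
  case=> t0 ts; split=> [i _|]; rewrite /nonneg /sum_le /= in_itv /= ?andbT //.
  by have := t0 i; rewrite mxE.
case=> t0 ts; split; last by move: ts; rewrite /sum_le /= in_itv.
by move=> i; have := t0 i I; rewrite /nonneg /= in_itv /= andbT mxE.
Qed.

Lemma is_derive_power_down n (s c x : R) :
  is_derive x 1 (fun y : R => c * (s - y) ^+ n) (- (c * (n%:R * (s - x) ^+ n.-1))).
Proof.
have dsub : is_derive x 1 (fun y : R => s - y) (- 1).
  by apply: is_derive_eq; rewrite add0r mul1r.
have dpow := is_deriveZ c (is_deriveX n dsub).
rewrite (_ : (fun y : R => _) = c \*: (fun y : R => s - y) ^+ n); last first.
  by apply/funext => y; rewrite /= exprfctE.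
by apply: is_derive_eq; rewrite /GRing.scale /= mulrN1 mulrN.
Qed.

Lemma integral_power_down d (s : R) : 0 <= s ->
  (\int[leb]_(x in `[0%R, s]) (d`!%:R^-1 * (s - x) ^+ d)%R%:E)%E =
  (d.+1`!%:R^-1 * s ^+ d.+1)%:E.
Proof.
rewrite le_eqVlt => /predU1P[<-|s0].
  by rewrite set_itv1 integral_set1 expr0n mulr0.
pose f (x : R) := d`!%:R^-1 * (s - x) ^+ d.
pose F (x : R) := - d.+1`!%:R^-1 * (s - x) ^+ d.+1.
have dF (x : R) : is_derive x 1 F (f x).
  have dF' := is_derive_power_down d.+1 s (- d.+1`!%:R^-1) x.
  apply: is_derive_eq; rewrite /f factS natrM invfM mulNr opprK /=.
  by rewrite mulrACA mulVf ?mul1r ?pnatr_eq0.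
have continuous_of (h h' : R -> R) :
    (forall x : R, is_derive x 1 h (h' x)) -> continuous h.
  move=> dh x; apply: differentiable_continuous; apply/derivable1_diffP.
  by have [] := dh x.
have cF := continuous_of _ _ dF.
rewrite (@continuous_FTC2 _ f F) //.
- by rewrite /F subrr subr0 expr0n mulr0 -EFinB sub0r mulNr opprK.
- apply: continuous_subspaceT.
  exact: continuous_of (is_derive_power_down d s d`!%:R^-1).
- split; [by move=> x _; have [] := dF x|exact/cvg_at_right_filter/cF|].
  exact/cvg_at_left_filter/cF.
- by move=> x _; rewrite derive1E; exact: derive_val.
Qed.

(** The slice at first coordinate x is the corner simplex of size s - x. *)
Lemma Vol_corner_simplex d (s : R) : 0 <= s ->
  Vol (@corner_simplex d s) = (d`!%:R^-1 * s ^+ d)%:E.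
Proof.
elim: d s => [|d IH] s s0.
  rewrite /Vol /= (_ : [set t | _] = setT) ?diracT ?expr0 ?invr1 ?mulr1 //.
  by apply/seteqP; split=> // t _; split=> [[]|] //=; rewrite big_ord0.
rewrite -integral_power_down // VolS [RHS]integral_mkcond.
apply: eq_integral => x _; rewrite patchE.
have sumE y : \sum_i (row_mx (const_mx x) y : 'rV_(1 + d)) 0 i = x + \sum_i y 0 i.
  rewrite big_split_ord /= big_ord1 row_mxEl mxE; congr (_ + _).
  by apply: eq_bigr => i _; rewrite row_mxEr.
have sub y : @corner_simplex d.+1 s (row_mx (const_mx x) y : 'rV_(1 + d)) <->
    0 <= x /\ @corner_simplex d (s - x) y.
  rewrite /corner_simplex /= sumE lerBrDl; split.
    case=> pos sm; split; first by have := pos (lshift d (0 : 'I_1)); rewrite (@row_mxEl _ 1 1 d) mxE.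
    by split=> // i; have := pos (rshift 1 i); rewrite (@row_mxEr _ 1 1 d).
  case=> x0 [pos sm]; split=> // i; case: (@split_ordP 1 d i) => j ->.
    by rewrite (@row_mxEl _ 1 1 d) mxE.
  by rewrite (@row_mxEr _ 1 1 d).
case: ifPn => [|/negP]; rewrite in_setE /= in_itv /=.
  move=> /andP[x0 xs]; rewrite -IH ?subr_ge0 //; congr Vol.
  by apply/seteqP; split => y /= => [/sub[]|yc] //; apply/sub.
move=> xs; rewrite (_ : [set y | _] = set0) ?/Vol ?measure0 //.
apply/seteqP; split=> // y /= /sub[x0 [pos sm]]; apply: xs; rewrite x0 /=.
by rewrite -subr_ge0 (le_trans _ sm) // sumr_ge0.
Qed.
End LebesgueTuple.

Section Barycentric.
Local Open Scope classical_set_scope.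
Variables (R : realType) (d : nat) (p : 'I_d.+1 -> 'rV[R]_d).

Definition edge_mx : 'M[R]_d := \matrix_i (p (lift ord0 i) - p ord0).

Hypothesis edge_unit : edge_mx \in unitmx.

Definition edge_coord (x : 'rV[R]_d) : 'rV[R]_d := (x - p ord0) *m invmx edge_mx.

Definition bary (x : 'rV[R]_d) (i : 'I_d.+1) : R :=
  oapp (edge_coord x 0) (1 - \sum_j edge_coord x 0 j) (unlift ord0 i).

Lemma bary0 x : bary x ord0 = 1 - \sum_j edge_coord x 0 j.
Proof. by rewrite /bary unlift_none. Qed.

Lemma bary_lift x i : bary x (lift ord0 i) = edge_coord x 0 i.
Proof. by rewrite /bary liftK. Qed.

Lemma sum_bary x : \sum_i bary x i = 1.
Proof.
rewrite big_ord_recl bary0 [X in _ + X](eq_bigr (edge_coord x 0)) ?subrK //.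
by move=> i _; rewrite bary_lift.
Qed.

Lemma mul_edge_mx (y : 'rV[R]_d) :
  y *m edge_mx = \sum_i y 0 i *: (p (lift ord0 i) - p ord0).
Proof. by rewrite mulmx_sum_row; apply: eq_bigr => i _; rewrite rowK. Qed.

Lemma affine_comb_edges (w : 'I_d.+1 -> R) : \sum_i w i = 1 ->
  \sum_i w i *: p i - p ord0 = (\row_i w (lift ord0 i)) *m edge_mx.
Proof.
rewrite big_ord_recl => w1; rewrite mul_edge_mx.
under [RHS]eq_bigr do rewrite mxE scalerBr.
rewrite sumrB -scaler_suml big_ord_recl addrAC -[X in _ - X]scale1r -w1 scalerDl.
by rewrite opprD addrA subrr sub0r addrC.
Qed.

Lemma baryE x : x = \sum_i bary x i *: p i.
Proof.
apply: (addIr (- p ord0)); rewrite affine_comb_edges ?sum_bary //.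
rewrite (_ : \row_i _ = edge_coord x); first by rewrite mulmxKV.
by apply/rowP => i; rewrite mxE bary_lift.
Qed.

Lemma bary_uniq (w : 'I_d.+1 -> R) : \sum_i w i = 1 ->
  bary (\sum_i w i *: p i) =1 w.
Proof.
move=> w1; have E : edge_coord (\sum_i w i *: p i) = \row_i w (lift ord0 i).
  by rewrite /edge_coord affine_comb_edges // mulmxK.
move=> i; case: (unliftP ord0 i) => [j ->|->]; first by rewrite bary_lift E mxE.
rewrite bary0 E -w1 big_ord_recl; under [X in _ - X]eq_bigr do rewrite mxE.
by rewrite addrK.
Qed.

Lemma bary_vertex i j : bary (p i) j = (i == j)%:R.
Proof.
have := @bary_uniq (fun j => (i == j)%:R).
rewrite (bigD1 i) //= eqxx big1 ?addr0 => [/(_ erefl)/(_ j) <-|l li].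
  congr (bary _ _); rewrite (bigD1 i) //= eqxx scale1r big1 ?addr0 // => l li.
  by rewrite eq_sym (negPf li) scale0r.
by rewrite eq_sym (negPf li).
Qed.

Lemma simplexP x : simplex p x <-> forall i, 0 <= bary x i.
Proof.
split=> [[w [w0 w1 ->]] i|b0]; first by rewrite bary_uniq.
by exists (bary x); split=> //; [apply: sum_bary|apply: baryE].
Qed.

Lemma simplex_corner : simplex p = [set x | corner_simplex 1 (edge_coord x)].
Proof.
apply/seteqP; split=> x /=; rewrite simplexP => b0.
  split=> [i|]; first by rewrite -bary_lift.
  by have := b0 ord0; rewrite bary0 subr_ge0.
case: b0 => b0 b1 i; case: (unliftP ord0 i) => [j ->|->]; rewrite ?bary_lift //.
by rewrite bary0 subr_ge0.
Qed.

(** The simplex is the preimage of the corner simplex of size 1 under the affine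
    map edge_coord, whose linear part has determinant 1 / det edge_mx. *)
Theorem Vol_simplex : Vol (simplex p) = (d`!%:R^-1 * `|\det edge_mx|)%:E.
Proof.
pose q := - p ord0 *m invmx edge_mx.
pose B : set 'rV[R]_d := [set y | corner_simplex 1 (y + q)].
have mB : measurable_rV B.
  by apply: measurable_translate_preimage; exact: measurable_corner_simplex.
have uW : invmx edge_mx \in unitmx by rewrite unitmx_inv.
have := vol_scales_unit uW mB.
rewrite Vol_translate ?Vol_corner_simplex //; last exact: measurable_corner_simplex.
rewrite (_ : [set x | B (x *m _)] = simplex p) => [E|]; last first.
  by rewrite simplex_corner /B /q; apply/funext => x /=; rewrite /edge_coord mulmxBl mulNmx.
have det0 : \det edge_mx != 0 by rewrite -unitfE -unitmxE.
rewrite det_inv normfV in E.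
have <- : (`|\det edge_mx|%:E * (`|\det edge_mx|^-1%:E * Vol (simplex p)) =
    Vol (simplex p))%E.
  by rewrite muleA -EFinM divff ?normr_eq0 // mul1e.
by rewrite -E -EFinM expr1n mulr1 mulrC.
Qed.

Lemma edge_coord_continuous i : continuous (fun x => edge_coord x 0 i).
Proof.
have -> : (fun x => edge_coord x 0 i) = (fun y : 'rV[R]_d =>
    \sum_j (y 0 j - p ord0 0 j) * invmx edge_mx j i).
  by apply/funext => y; rewrite mxE; apply: eq_bigr => j _; rewrite !mxE.
apply: continuous_big => [|j _ x]; first exact: add_continuous.
apply: (@continuousM _ _ (fun y : 'rV[R]_d => y 0 j - p ord0 0 j)
  (cst (invmx edge_mx j i))); last exact: cst_continuous.
apply: (@continuousB _ _ _ (fun y : 'rV[R]_d => y 0 j) (cst (p ord0 0 j))).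
  exact: coord_continuous.
exact: cst_continuous.
Qed.

Lemma bary_continuous i : continuous (bary ^~ i).
Proof.
case: (unliftP ord0 i) => [j ->|->].
  have -> : bary ^~ (lift ord0 j) = (fun y => edge_coord y 0 j).
    by apply/funext => y; rewrite bary_lift.
  exact: edge_coord_continuous.
have -> : bary ^~ ord0 = (fun y => 1 - \sum_j edge_coord y 0 j).
  by apply/funext => y; rewrite bary0.
move=> x; apply: (@continuousB _ _ _ (cst (1 : R))
  (fun y : 'rV[R]_d => \sum_j edge_coord y 0 j : R)); first exact: cst_continuous.
move: x; apply: continuous_big => [|j _]; first exact: add_continuous.
exact: edge_coord_continuous.
Qed.

(** A point of the simplex with a vanishing i-th coordinate leaves the simplex
    when it is moved away from the i-th vertex. *)
Lemma interior_simplexP x : interior (simplex p) x <-> forall i, 0 < bary x i.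
Proof.
split=> [xT i|b0]; last first.
  have: \forall y \near x, forall i, 0 < bary y i.
    apply: (@filter_forall _ _ (fun i => [set y | 0 < bary y i]) (nbhs x)) => i.
    exact: (cvgr_gt _ (@bary_continuous i x) _ (b0 i)).
  by apply: filterS => y by0; apply/simplexP => i; apply: ltW.
have bxi : 0 <= bary x i by move: i; apply/simplexP; exact: interior_subset.
rewrite lt_neqAle bxi andbT eq_sym; apply/eqP => bxi0.
pose g (t : R) := x + t *: (x - p i).
have gx : g t @[t --> (0 : R)] --> x + (0 : R) *: (x - p i).
  apply: cvgD; first exact: cvg_cst.
  by apply: cvgZ; [exact: cvg_id|exact: cvg_cst].
rewrite scale0r addr0 in gx.
have gbary t : bary (g t) i = - t.
  pose w j := (1 + t) * bary x j - t * (i == j)%:R.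
  have w1 : \sum_j w j = 1.
    rewrite sumrB -!mulr_sumr sum_bary (bigD1 i) //= eqxx big1 => [|j ji].
      by rewrite addr0 !mulr1 addrK.
    by rewrite eq_sym (negPf ji).
  have -> : g t = \sum_j w j *: p j.
    under eq_bigr do rewrite scalerBl -!scalerA.
    rewrite sumrB -!scaler_sumr -baryE (bigD1 i) //= eqxx scale1r big1 => [|j ji].
      by rewrite addr0 scalerDl scale1r /g scalerBr addrA.
    by rewrite eq_sym (negPf ji) scale0r.
  by rewrite bary_uniq // /w bxi0 eqxx mulr0 mulr1 sub0r.
have : \forall t \near 0^'+, simplex p (g t) by apply: cvg_at_right_filter gx _ xT.
move=> gT; have [t [t0 gt]] : exists t, 0 < t /\ simplex p (g t).
  near (0 : R)^'+ => t; exists t; split; first by near: t; exact: nbhs_right_gt.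
  by near: t.
have /simplexP/(_ i) := gt; rewrite gbary oppr_ge0.
by rewrite leNgt t0.
Unshelve. all: by end_near.
Qed.

End Barycentric.
(** * Interior lattice points as elements of age one *)

Section FiniteCardinal.
Local Open Scope classical_set_scope.

Lemma card_eq_finset (G : finType) (S : {set G}) (k : nat) :
  ([set x | x \in S] #= `I_k)%card -> #|S| = k.
Proof.
move=> Sk; apply/(@card_eq_II #|S| k); apply: card_eq_trans Sk.
have [S0|[x0 x0S]] := set_0Vmem S.
  rewrite (_ : [set x | x \in S] = set0) ?S0 ?cards0 ?II0 //.
  by apply/seteqP; split=> x //=; rewrite inE.
rewrite card_eq_sym (_ : [set x | x \in S] = nth x0 (enum S) @` `I_#|S|).
  apply: inj_card_eq => i j /set_mem iS /set_mem jS /eqP.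
  by rewrite nth_uniq -?cardE ?enum_uniq // => /eqP.
apply/seteqP; split=> x /= => [xS|[i iS <-]]; last first.
  by rewrite -mem_enum mem_nth -?cardE.
by exists (index x (enum S)); rewrite ?nth_index ?mem_enum // cardE index_mem mem_enum.
Qed.

End FiniteCardinal.

Section LatticeSimplex.
Local Open Scope classical_set_scope.
Variables (R : realType) (d N : nat) (v : 'I_d.+1 -> 'rV[int]_d).
Hypothesis d_gt0 : (0 < d)%N.
Hypothesis N_gt1 : (1 < N)%N.
Hypothesis det_v : `|\det (lattice_edges v)|%N = N.

Let W := lattice_edges v.
Let p (i : 'I_d.+1) : 'rV[R]_d := real_point R (v i).

Let N_gt0 : (0 < N)%N. Proof. exact: ltnW. Qed.
Let N_neq0 : (N%:R : R) != 0. Proof. by rewrite pnatr_eq0 -lt0n. Qed.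

Lemma edge_mx_lattice : edge_mx p = map_mx intr W.
Proof. by apply/matrixP => i j; rewrite !mxE intrB. Qed.

Lemma edge_lattice_unit : edge_mx p \in unitmx.
Proof.
rewrite edge_mx_lattice unitmxE det_map_mx unitfE intr_eq0.
by rewrite -absz_eq0 det_v -lt0n.
Qed.

Lemma bary_of_scaled (n z : 'rV[int]_d) :
    n *m W = N%:Z *: (z - v ord0) ->
  forall i, bary p (real_point R z) (lift ord0 i) = (n 0 i)%:~R / N%:R.
Proof.
move=> nW i; rewrite bary_lift /edge_coord.
have -> : real_point R z - p ord0 = (N%:R^-1 *: map_mx intr n) *m edge_mx p.
  rewrite -scalemxAl edge_mx_lattice -map_mxM /= nW.
  apply/rowP => j; rewrite !mxE intrM intrB mulrA.
  by rewrite -[(Posz N)%:~R]/(N%:R) mulVf ?mul1r.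
by rewrite mulmxK ?edge_lattice_unit // !mxE mulrC.
Qed.

(** Cramer's rule, with the sign chosen to have N rather than det W as factor. *)
Definition scaled_coords (z : 'rV[int]_d) : 'rV[int]_d :=
  sgz (\det W) *: ((z - v ord0) *m \adj W).

Lemma scaled_coordsE z : scaled_coords z *m W = N%:Z *: (z - v ord0).
Proof.
rewrite /scaled_coords -scalemxAl -mulmxA mul_adj_mx mul_mx_scalar scalerA.
by rewrite -det_v -abszEsg.
Qed.

Definition box_row (x : box N W) : 'rV[int]_d := \row_i (box_nat (lift ord0 i) x)%:Z.

Definition box_point (x : box N W) : 'rV[int]_d :=
  v ord0 + \row_i ((box_row x *m W) 0%R i %/ N)%Z.

Lemma box_rowE (x : box N W) : box_row x *m W = N%:Z *: (box_point x - v ord0).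
Proof.
apply/rowP => i; rewrite /box_point addrC addKr [RHS]mxE [X in _ * X]mxE mulrC divzK //.
rewrite -intr_Zp_eq0 //; have /rowP/(_ i) : map_mx intr (box_row x *m W) = 0 :> 'rV['Z_N]_d.
  have /eqP <- := box_valP x; rewrite map_mxM; congr (_ *m _).
  by apply/rowP => j; rewrite 2!mxE /box_nat /box_coord fintype.liftK; exact: natr_Zp.
by rewrite mxE [RHS]mxE => ->.
Qed.

Lemma bary_box_point (x : box N W) j : box_age x = 1%N ->
  bary p (real_point R (box_point x)) j = (box_nat j x)%:R / N%:R.
Proof.
move=> x1; have lifted i : bary p (real_point R (box_point x)) (lift ord0 i) =
    (box_nat (lift ord0 i) x)%:R / N%:R.
  by rewrite (bary_of_scaled (box_rowE x)) mxE.
case: (unliftP ord0 j) => [i ->//|->].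
have := sum_bary p (real_point R (box_point x)).
rewrite big_ord_recl; under eq_bigr do rewrite lifted.
move=> /(canRL (addrK _)) ->; rewrite -mulr_suml -natr_sum.
have := sum_box_nat N_gt1 x; rewrite x1 muln1 big_ord_recl => /eqP.
rewrite -(eqr_nat R) natrD => /eqP sumN; apply: (mulIf N_neq0).
by rewrite mulrBl mul1r !divfK // -sumN addrK.
Qed.

Let T : set 'rV[R]_d := lattice_simplex v.
Hypothesis clean_T : clean v T.

(** An element of age 1 with a vanishing coordinate would give a lattice point on
    a facet, hence a vertex; but the coordinates of a vertex are integers. *)
Lemma box_nat_gt0 (x : box N W) : box_age x = 1%N -> forall j, (0 < box_nat j x)%N.
Proof.
move=> x1 j; rewrite lt0n; apply/eqP => xj0.
have baryx := bary_box_point _ x1.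
have [|i zi] := @clean_T (box_point x).
  split; last first.
    move=> /(interior_simplexP edge_lattice_unit)/(_ j).
    by rewrite baryx xj0 mul0r ltxx.
  apply: subset_closure; apply/(simplexP edge_lattice_unit) => i.
  by rewrite baryx divr_ge0.
have := baryx i; rewrite zi (bary_vertex edge_lattice_unit) eqxx => /esym/eqP.
rewrite (can2_eq (divfK N_neq0) (mulfK N_neq0)) mul1r eqr_nat => /eqP iN.
by have := box_nat_lt N_gt1 i x; rewrite iN ltnn.
Qed.

Lemma box_point_interior (x : box N W) : box_age x = 1%N ->
  interior_lattice_points T (box_point x).
Proof.
move=> x1; apply/(interior_simplexP edge_lattice_unit) => j.
by rewrite (bary_box_point _ x1) divr_gt0 ?ltr0n ?box_nat_gt0.
Qed.

Lemma box_point_inj :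
  {in [set x : box N W | box_age x = 1%N] &, injective box_point}.
Proof.
move=> x y /set_mem x1 /set_mem y1 xy; apply: (box_nat_inj) => j; apply/eqP.
rewrite -(eqr_nat R); apply/eqP/(mulIf (invr_neq0 N_neq0)).
by rewrite -!bary_box_point // xy.
Qed.

(** The scaled coordinates of an interior lattice point are positive and add up to
    N, so they are smaller than N and are not changed by reduction modulo N. *)
Lemma box_point_surj z : interior_lattice_points T z ->
  exists2 x : box N W, box_age x = 1%N & box_point x = z.
Proof.
move=> /(interior_simplexP edge_lattice_unit) z_gt0.
pose n := scaled_coords z; have nW : n *m W = _ := scaled_coordsE z.
have nE := bary_of_scaled nW.
have n_gt0 i : 0 < n 0 i.
  by have := z_gt0 (lift ord0 i); rewrite nE pmulr_lgt0 ?invr_gt0 ?ltr0n // ltr0z.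
have n_sum : \sum_i n 0 i < N%:Z.
  have := z_gt0 ord0; rewrite bary0; under eq_bigr do rewrite -bary_lift nE.
  rewrite -mulr_suml -rmorph_sum /= subr_gt0 ltr_pdivrMr ?ltr0n // mul1r.
  by rewrite -[N%:R]/((Posz N)%:~R) ltr_int.
pose m i := absz (n 0 i).
have mE i : n 0 i = (m i)%:Z by rewrite /m gez0_abs // ltW.
have m_sum : (\sum_i m i < N)%N.
  by rewrite -ltz_nat -natz natr_sum; under eq_bigr do rewrite natz -mE.
have m_gt0 i : (0 < m i)%N by rewrite -ltz_nat -mE.
have m_lt i : (m i < N)%N by apply: leq_ltn_trans m_sum; rewrite (bigD1 i) ?leq_addr.
have xP : (\row_i (m i)%:R : 'rV['Z_N]_d) \in @box_pred d N W.
  rewrite unfold_in; have -> : \row_i (m i)%:R = map_mx intr n :> 'rV['Z_N]_d.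
    by apply/rowP => i; rewrite [RHS]mxE mE mxE.
  rewrite -map_mxM /= nW; apply/eqP/rowP => i; rewrite 2!mxE [RHS]mxE; apply/eqP.
  by rewrite intr_Zp_eq0 // dvdz_mulr.
pose x := Box xP.
have x_lift i : box_nat (lift ord0 i) x = m i.
  by rewrite /box_nat /box_coord liftK /= mxE val_Zp_nat // modn_small.
have x1 : box_age x = 1%N.
  have := sum_box_nat N_gt1 x; rewrite big_ord_recl (eq_bigr m) => [|i _]; last exact: x_lift.
  have := box_nat_lt N_gt1 ord0 x.
  have : (0 < \sum_i m i)%N.
    by rewrite (bigD1 (Ordinal d_gt0)) //= addn_gt0 m_gt0.
  have quot1 (a b q : nat) : (b < N -> 0 < b -> a < N -> a + b = N * q -> q = 1)%N.
    by clear; case: q => [|[|q]] //; nia.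
  by move=> s0 aN; apply: quot1.
exists x => //.
have xn : box_row x = n by apply/rowP => i; rewrite mxE x_lift mE.
have := box_rowE x; rewrite xn nW.
move=> /rowP E; apply: (addIr (- v ord0)); apply/rowP => i; apply/esym.
have N0 : N%:Z != 0 by rewrite eqz_nat -lt0n.
by apply: (mulfI N0); have := E i; rewrite mxE [RHS]mxE.
Qed.

Lemma card_box_age1 (k : nat) : (interior_lattice_points T #= `I_k)%card ->
  #|[set x : box N W | box_age x == 1%N]%SET| = k.
Proof.
move=> Tk; apply: card_eq_finset; apply: card_eq_trans Tk.
rewrite (_ : [set x | _] = [set x : box N W | box_age x = 1%N]); last first.
  by apply/seteqP; split=> x /=; rewrite inE => /eqP.
rewrite card_eq_sym (_ : interior_lattice_points T =
  box_point @` [set x : box N W | box_age x = 1%N]).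
  exact: inj_card_eq box_point_inj.
apply/seteqP; split=> [z /box_point_surj[x x1 xz]|_ [x x1 <-]]; first by exists x.
exact: box_point_interior.
Qed.

(** The coordinates of x add up to N, so the relation that defines box_point x can
    be based at any vertex. *)
Lemma sum_edges_box_point (x : box N W) (i0 : 'I_d.+1) : box_age x = 1%N ->
    (forall j, j != i0 -> box_nat j x = 1%N) ->
  \sum_i (v i - v i0) = (box_point x - v i0) *+ N.
Proof.
move=> x1 xj.
have rel : \sum_j (v j - v ord0) *+ box_nat j x = (box_point x - v ord0) *+ N.
  rewrite big_ord_recl subrr mul0rn add0r -[RHS]scaler_nat natz -box_rowE mulmx_sum_row.
  by apply: eq_bigr => i _; rewrite rowK mxE -[LHS]scaler_nat natz.
have sumN : (\sum_j box_nat j x = N)%N by rewrite sum_box_nat // x1 muln1.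
have -> : \sum_i (v i - v i0) = \sum_j (v j - v i0) *+ box_nat j x.
  rewrite [LHS](bigD1 i0) // [RHS](bigD1 i0) //= subrr mul0rn; congr (_ + _).
  by apply: eq_bigr => j ji; rewrite xj.
have -> : \sum_j (v j - v i0) *+ box_nat j x =
    \sum_j ((v j - v ord0) *+ box_nat j x - (v i0 - v ord0) *+ box_nat j x).
  by apply: eq_bigr => j _; rewrite -mulrnBl opprB addrA subrK.
by rewrite sumrB rel sumrMnr sumN -mulrnBl opprB addrA subrK.
Qed.

End LatticeSimplex.

(** * Clean simplices of smallest volume *)

Lemma unit_of_free (F : fieldType) (n : nat) (f : 'I_n -> 'rV[F]_n) :
  free [seq f i | i : 'I_n] -> (\matrix_i f i) \in unitmx.
Proof.
move=> f_free; have /freeP tuple_free : free [tuple f i | i < n] by exact: f_free.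
rewrite -row_free_unit; apply: inj_row_free => u u0; apply/rowP => i.
rewrite mxE; apply: (tuple_free (u 0)); rewrite -[RHS]u0 mulmx_sum_row.
by apply: eq_bigr => j _; rewrite rowK -tnth_nth tnth_mktuple.
Qed.

Theorem theorem7p2 (R : realType) (d k : nat) (hd : (3 <= d)%N) (hk : (1 <= k)%N)
    (T : set 'rV[R]_d) (hT : clean_simplices R d k T)
    (hvol : Vol T = ((d`!%:R)^-1 * (d * k + 1)%:R)%:E) :
  unimodularly_equivalent T
    (T_simplex
       (\row_(j < d) (if (j.+1 < d)%N then (d * k)%:Z else (d * k + 1)%:Z))).
Proof.
case: hT => v [[v_indep TE] T_clean T_card].
pose N := (d * k + 1)%N; pose W := lattice_edges v.
have d_gt0 : (0 < d)%N by apply: leq_trans hd.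
have N_gt1 : (1 < N)%N by rewrite /N addn1 ltnS muln_gt0 d_gt0.
have edgeE : edge_mx (fun i => real_point R (v i)) = map_mx intr W.
  exact: edge_mx_lattice.
have edge_unit : edge_mx (fun i => real_point R (v i)) \in unitmx.
  exact: unit_of_free v_indep.
have det_v : `|\det W|%N = N.
  have := Vol_simplex edge_unit; rewrite -/(lattice_simplex v) -TE hvol.
  move=> [] /(mulfI _); rewrite invr_eq0 pnatr_eq0 -lt0n fact_gt0.
  move=> /(_ isT); rewrite edgeE det_map_mx -intr_norm => /eqP.
  by rewrite -[(d * k + 1)%:R]/((Posz N)%:~R) eqr_int -abszE => /eqP[].
rewrite TE in T_clean T_card.
have := @exists_unit_coordinates (box N W) d k (@box_nat d N W) (@box_age d N W) hd hk.
case=> //.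
- exact: box_nat_lt.
- exact: box_natD.
- exact: sum_box_nat.
- by move=> x x0; apply: (box_nat_inj) => j; rewrite x0 box_nat0.
- exact: card_box.
- exact: card_box_age1 d_gt0 N_gt1 det_v T_clean _ T_card.
- exact: box_nat_gt0 N_gt1 det_v T_clean.
move=> g [i0 [g1 gj]].
have rel := sum_edges_box_point N_gt1 g1 gj.
rewrite TE; move: (box_point g) rel => z rel {g g1 gj}.
rewrite {T T_clean T_card TE hvol v_indep edge_unit edgeE}.
rewrite /W /N in det_v rel; clear W N N_gt1.
case: d hd d_gt0 v det_v i0 z rel => // d' _ _ v det_v i0 z rel.
by apply: (unimodular_of_relation _ _ rel); rewrite -abszE det_v.
Qed.
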